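(* Assume $X$ is a dual Banach space with a conditional spreading basis $(x_i)$. Then $c_0$ does not coarsely embed into $X$.
   Context: A basis $(x_i)$ is spreading if $\big\|\sum_{i=1}^{\infty}a_ix_i\big\|=\big\|\sum_{i=1}^{\infty}a_ix_{n_i}\big\|$ for all (finitely supported) scalar sequences $(a_i)$ and all $n_1<n_2<\cdots$ in $\mathbb{N}$. It is conditional if it is not unconditional. A dual Banach space is one that is the dual of some Banach space. A map $\phi:X_1\to X_2$ between metric spaces is a coarse embedding if there are nondecreasing functions $\rho,\omega:[0,\infty)\to[0,\infty)$ with $\lim_{t\to\infty}\rho(t)=\infty$ and $\rho(d(x,y))\le d(\phi(x),\phi(y))\le\omega(d(x,y))$ for all $x,y\in X_1$. *)

(* Defs.v *)
(* The scalar field is the field of real numbers throughout. *)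
From HB Require Import structures.
From mathcomp Require Import all_boot all_order all_algebra.
From mathcomp Require Import all_classical all_reals all_analysis.

Set Implicit Arguments.
Unset Strict Implicit.
Unset Printing Implicit Defensive.

Import Order.TTheory GRing.Theory Num.Theory.
Import numFieldNormedType.Exports.

Local Open Scope classical_set_scope.
Local Open Scope ring_scope.

Section c0_space.
Context {R : realType}.

Definition null_seq : {pred (nat -> R^o)} :=
  mem [set u : nat -> R^o | u @ \oo --> (0 : R)].

Record c0 := C0 { c0_val :> nat -> R^o ; c0_valP : c0_val \in null_seq }.

HB.instance Definition _ := [isSub for c0_val].
HB.instance Definition _ := [Choice of c0 by <:].

Lemma null_seq_submod : submod_closed null_seq.
Proof.
split; first by rewrite inE /=; exact: cvg_cst.
move=> a u v; rewrite !inE /= => u0 v0.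
have -> : (0 : R) = a *: (0 : R^o) + 0 by rewrite scaler0 addr0.
by apply: cvgD => //; exact: cvgZl_tmp.
Qed.

HB.instance Definition _ := GRing.isSubmodClosed.Build _ _ null_seq
  null_seq_submod.
HB.instance Definition _ := [SubChoice_isSubLmodule of c0 by <:].

Definition c0_norm (u : c0) : R := sup (range (fun n => `|c0_val u n|)).

Lemma c0_has_sup (u : c0) : has_sup (range (fun n => `|c0_val u n|)).
Proof.
split; first by exists `|c0_val u 0%N|, 0%N.
have /set_mem/= cu := c0_valP u.
have /cvg_seq_bounded/bounded_fun_has_ubound[M Mu] : cvgn (fun n => `|c0_val u n|).
  by apply: is_cvg_norm; apply/cvg_ex; exists 0.
by exists M.
Qed.

Lemma c0_norm_ub (u : c0) n : `|c0_val u n| <= c0_norm u.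
Proof. by apply: (ub_le_sup (c0_has_sup u).2); exists n. Qed.

Lemma c0_norm_le (u : c0) M : (forall n, `|c0_val u n| <= M) -> c0_norm u <= M.
Proof.
by move=> uM; apply: (ge_sup (c0_has_sup u).1) => _ [n _ <-].
Qed.

Lemma c0_normD u v : c0_norm (u + v) <= c0_norm u + c0_norm v.
Proof.
by apply: c0_norm_le => n; rewrite (le_trans (ler_normD _ _))// lerD// c0_norm_ub.
Qed.

Lemma c0_normZ (a : R) u : c0_norm (a *: u) = `|a| * c0_norm u.
Proof.
have le b v : c0_norm (b *: v) <= `|b| * c0_norm v.
  by apply: c0_norm_le => n; rewrite normrM ler_wpM2l// c0_norm_ub.
apply/eqP; rewrite eq_le le /=; have [->|a0] := eqVneq a 0.
  by rewrite normr0 mul0r (le_trans _ (c0_norm_ub _ 0%N)).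
rewrite -ler_pdivlMl ?normr_gt0// -normfV (le_trans _ (le _ _))//.
by rewrite scalerA mulVf// scale1r.
Qed.

Lemma c0_norm0_eq0 u : c0_norm u = 0 -> u = 0.
Proof.
move=> u0; apply/val_inj/funext => n.
by apply/eqP; rewrite -normr_le0 -u0 c0_norm_ub.
Qed.

HB.instance Definition _ :=
  Lmodule_isNormed.Build R c0 c0_normD c0_normZ c0_norm0_eq0.

End c0_space.
Arguments c0 R : clear implicits.

Section topological_dual.
Context {R : realType} {Y : normedModType R}.

Definition cont_linear : {pred (Y -> R^o)} :=
  mem [set f : Y -> R^o | linear f /\ continuous f].

Record dual :=
  Dual { dual_val :> Y -> R^o ; dual_valP : dual_val \in cont_linear }.

HB.instance Definition _ := [isSub for dual_val].
HB.instance Definition _ := [Choice of dual by <:].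

Lemma cont_linear_submod : submod_closed cont_linear.
Proof.
split.
  rewrite inE /=; split; last by move=> ?; exact: cvg_cst.
  by move=> a x y /=; rewrite scaler0 addr0.
move=> a f g; rewrite !inE /= => -[lf cf] [lg cg]; split.
  move=> b x y; rewrite /= !fctE lf lg !scalerDr !scalerA (mulrC a b).
  by rewrite !addrA; congr (_ + _); rewrite -!addrA; congr (_ + _); rewrite addrC.
by move=> x; apply: cvgD; [apply: cvgZl_tmp; exact: cf|exact: cg].
Qed.

HB.instance Definition _ := GRing.isSubmodClosed.Build _ _ cont_linear
  cont_linear_submod.
HB.instance Definition _ := [SubChoice_isSubLmodule of dual by <:].

Definition dual_norm (f : dual) : R :=
  sup [set `|dual_val f y| | y in [set y : Y | `|y| <= 1]].

Lemma dual_has_sup (f : dual) :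
  has_sup [set `|dual_val f y| | y in [set y : Y | `|y| <= 1]].
Proof.
split; first by exists `|dual_val f 0|, 0 => //=; rewrite normr0.
have /set_mem/= [lf cf] := dual_valP f.
pose g : {linear Y -> R^o} :=
  HB.pack (dual_val f) (GRing.isLinear.Build _ _ _ _ (dual_val f) lf).
have /linear_bounded_continuous/linear_boundedP/pinfty_ex_gt0[r r0 fr] :
  continuous g by exact: cf.
exists r => _ [y /= y1 <-]; rewrite (le_trans (fr y))//.
by rewrite ler_piMr// ltW.
Qed.

Lemma dual_norm_ub (f : dual) y : `|y| <= 1 -> `|dual_val f y| <= dual_norm f.
Proof. by move=> y1; apply: (ub_le_sup (dual_has_sup f).2); exists y. Qed.

Lemma dual_norm_le (f : dual) M :
  (forall y, `|y| <= 1 -> `|dual_val f y| <= M) -> dual_norm f <= M.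
Proof.
by move=> fM; apply: (ge_sup (dual_has_sup f).1) => _ [y y1 <-]; exact: fM.
Qed.

Lemma dual_normD f g : dual_norm (f + g) <= dual_norm f + dual_norm g.
Proof.
apply: dual_norm_le => y y1.
by rewrite (le_trans (ler_normD _ _))// lerD// dual_norm_ub.
Qed.

Lemma dual_normZ (a : R) f : dual_norm (a *: f) = `|a| * dual_norm f.
Proof.
have le b g : dual_norm (b *: g) <= `|b| * dual_norm g.
  by apply: dual_norm_le => y y1; rewrite normrM ler_wpM2l// dual_norm_ub.
apply/eqP; rewrite eq_le le /=; have [->|a0] := eqVneq a 0.
  by rewrite normr0 mul0r (le_trans _ (dual_norm_ub _ (_ : `|0| <= 1)))// normr0.
rewrite -ler_pdivlMl ?normr_gt0// -normfV (le_trans _ (le _ _))//.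
by rewrite scalerA mulVf// scale1r.
Qed.

Lemma dual_norm0_eq0 f : dual_norm f = 0 -> f = 0.
Proof.
move=> f0; apply/val_inj/funext => y /=.
have /set_mem/= [lf _] := dual_valP f.
pose g : {linear Y -> R^o} :=
  HB.pack (dual_val f) (GRing.isLinear.Build _ _ _ _ (dual_val f) lf).
have [->|y0] := eqVneq y 0; first exact: (linear0 g).
have ny : `|y| != 0 by rewrite normr_eq0.
have /eqP : dual_val f (`|y|^-1 *: y) = 0.
  by apply/eqP; rewrite -normr_le0 -f0 dual_norm_ub// normfZV.
have -> : dual_val f (`|y|^-1 *: y) = `|y|^-1 *: dual_val f y.
  exact: (linearZ_LR g).
by rewrite scaler_eq0 invr_eq0 (negPf ny) => /eqP.
Qed.

HB.instance Definition _ :=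
  Lmodule_isNormed.Build R dual dual_normD dual_normZ dual_norm0_eq0.

End topological_dual.
Arguments dual {R} Y.

(* Identification with a dual is isometric, the norm of X being part of the
   data: spreading is not invariant under renorming. *)
Definition is_dual_space (R : realType) (X : normedModType R) : Prop :=
  exists (Y : completeNormedModType R) (T : {linear X -> dual Y}),
    bijective T /\ forall x, `|T x| = `|x|.

Section bases.
Context {R : realType} {X : normedModType R}.
Implicit Type e : nat -> X.

Definition schauder_basis e : Prop :=
  forall x : X, exists! a : nat -> R, series (fun i => a i *: e i) @ \oo --> x.

(* A finitely supported sequence is a truncation of an arbitrary a at some N. *)
Definition spreading e : Prop :=
  forall (a : nat -> R) (N : nat) (n : nat -> nat),
    {homo n : i j / (i < j)%N} ->
    `|\sum_(i < N) a i *: e i| = `|\sum_(i < N) a i *: e (n i)|.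

(* When e is a basis, the convergent series below are exactly the basis
   expansions of the vectors of X. *)
Definition unconditional e : Prop :=
  forall a : nat -> R, cvgn (series (fun i => a i *: e i)) ->
    forall s : nat -> nat, bijective s ->
      cvgn (series (fun i => a (s i) *: e (s i))).

Definition conditional_spreading_basis e : Prop :=
  [/\ schauder_basis e, spreading e & ~ unconditional e].

End bases.

Section coarse.
Context {R : realType}.

(* Maps from [0, +oo) to itself are represented by functions R -> R of which
   only the values on nonnegative reals are constrained. *)
Definition coarse_embedding (A B : Type) (dA : A -> A -> R) (dB : B -> B -> R)
    (phi : A -> B) : Prop :=
  exists rho omega : R -> R,
    [/\ forall t, 0 <= t -> 0 <= rho t /\ 0 <= omega t,
        forall s t, 0 <= s -> s <= t -> rho s <= rho t /\ omega s <= omega t,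
        rho t @[t --> +oo] --> +oo
      & forall x y, rho (dA x y) <= dB (phi x) (phi y) <= omega (dA x y)].

Definition coarsely_embeds (V W : normedModType R) : Prop :=
  exists phi : V -> W,
    coarse_embedding (fun x y : V => `|x - y|) (fun x y : W => `|x - y|) phi.

End coarse.

(* Main.v *)
(* A polynomial p stands for the vector sum_i p_i e_i, so that p.[1] is the sum of
   its coefficients. Spreading lets one average a block of a vector over its
   shifts for free. Hence a block with coefficient sum 0 can be deleted without
   increasing the norm, and any other block asymptotically only counts through its
   coefficient sum. For a conditional basis the summing functional is then bounded,
   and as X is a separable dual it contains no c_0, so that infinitely many
   successive zero-sum blocks of norms bounded below have unbounded sums. In
   particular the basis is boundedly complete, and bounded sequences of X have
   coordinatewise limits in X along an ultrafilter.

   Let phi : c_0 -> X be a coarse embedding, with upper control omega, and let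
   f(n_1, ..., n_k) be the image of s_(n_1) + ... + s_(n_k), where s is the summing
   basis of c_0. Iterated limits write f, for sparse n, as a constant plus k
   successive blocks whose coefficient sums c_1, ..., c_k do not depend on n.
   Interlaced tuples have images at distance at most omega(1); averaging all blocks
   gives a uniform bound for a combination of "waves" (differences of two successive
   averages) with coefficients c_j, and since sums of waves are unbounded, for k
   large some run of l consecutive c_j is small. Take two tuples n and m that differ
   exactly on this run, where n precedes m entirely, and pair each of them with an
   interlaced companion. In f(n) - f(n') - f(m) + f(m'), whose norm is at most
   2 omega(1), the blocks of the companions have almost zero sums, and deleting them
   bounds f(n) - f(m) independently of l, although the points of c_0 are at
   distance at least l. *)
Require Import Defs.
From HB Require Import structures.
From mathcomp Require Import all_boot all_order all_algebra.
From mathcomp Require Import all_classical all_reals all_analysis.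
From mathcomp Require Import ring lra zify.

Set Implicit Arguments.
Unset Strict Implicit.
Unset Printing Implicit Defensive.

Import Order.TTheory GRing.Theory Num.Theory.
Import numFieldNormedType.Exports.

Local Open Scope ring_scope.

(** * Finitely supported vectors as polynomials *)

Section polynomials.
Context {R : realType}.
Implicit Types (p q u v b : {poly R}) (a m n T : nat).

Definition avg T : {poly R} := T%:R^-1 *: \sum_(s < T) 'X^s.

Definition suppress (F : pred nat) p : {poly R} :=
  \poly_(i < size p) (if F i then p`_i else 0).

(** Multiplication by ['X^n] shifts a vector by [n] places. Under [fits] this is a succession of
    blocks, the [t]-th one living in the slot from [a t] up to, but excluding, [a t.+1]. *)
Definition conf (a : nat -> nat) m (b : nat -> {poly R}) : {poly R} :=
  \sum_(t < m) 'X^(a t) * b t.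

Definition fits (a : nat -> nat) m (b : nat -> {poly R}) : Prop :=
  forall t, (t < m)%N -> (a t + size (b t) <= a t.+1)%N.

Lemma size_XnMle n p : (size ('X^n * p)%R <= n + size p)%N.
Proof.
have [->|p0] := eqVneq p 0; first by rewrite mulr0 size_poly0.
by rewrite mulrC size_mulXn.
Qed.

Lemma size_addXn u a v : (size u <= a)%N -> (size (u + 'X^a * v)%R <= a + size v)%N.
Proof.
move=> ua; rewrite (leq_trans (size_polyD _ _))// geq_max size_XnMle andbT.
by rewrite (leq_trans ua)// leq_addr.
Qed.

Lemma size_addXn_le u a v c : (size u <= a)%N -> (size v <= c)%N ->
  (size (u + 'X^a * v)%R <= a + c)%N.
Proof. by move=> ua vc; rewrite (leq_trans (size_addXn _ ua))// leq_add2l. Qed.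

Lemma size_avg T : (size (avg T) <= T)%N.
Proof.
rewrite (leq_trans (size_scale_leq _ _))// (leq_trans (size_sum _ _ _))//.
by apply/bigmax_leqP => i _; rewrite size_polyXn.
Qed.

Lemma avg_horner1 T : (0 < T)%N -> (avg T).[1] = 1.
Proof.
move=> T0; rewrite /avg hornerZ horner_sum.
under eq_bigr do rewrite hornerXn expr1n.
by rewrite sumr_const card_ord mulVf// pnatr_eq0 -lt0n.
Qed.

(** The geometric sum telescopes against ['X - 1]. Zero-sum vectors are the multiples of ['X - 1],
    so their averages have norm of order [1/T]. *)
Lemma avgM_subX1 T q : avg T * (('X - 1) * q) = T%:R^-1 *: ('X^T * q - q).
Proof.
rewrite /avg -scalerAl; congr (_ *: _).
have -> : 'X^T * q - q = ('X^T - 1) * q by rewrite mulrBl mul1r.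
by rewrite subrX1 mulrCA mulrA.
Qed.

Lemma root1_factor b : b.[1] = 0 -> {q | b = ('X - 1) * q}.
Proof.
move=> /eqP/factor_theorem qE; have /cid[q ->] := qE.
by exists q; rewrite mulrC.
Qed.

Lemma conf0 (a : nat -> nat) (b : nat -> {poly R}) : conf a 0 b = 0. Proof. by rewrite /conf big_ord0. Qed.

Lemma confS (a : nat -> nat) m (b : nat -> {poly R}) : conf a m.+1 b = conf a m b + 'X^(a m) * b m.
Proof. by rewrite /conf big_ord_recr. Qed.

Lemma size_conf (a : nat -> nat) m (b : nat -> {poly R}) : fits a m b -> (size (conf a m b) <= a m)%N.
Proof.
elim: m => [|m IH] fa; first by rewrite conf0 size_poly0.
rewrite confS (leq_trans (size_addXn _ _)) ?fa//.
by apply: IH => t tm; apply: fa; apply: leq_trans tm _.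
Qed.

Lemma eq_conf (a : nat -> nat) m (b b' : nat -> {poly R}) : (forall t, (t < m)%N -> b t = b' t) ->
  conf a m b = conf a m b'.
Proof. by move=> bb; apply: eq_bigr => i _; rewrite bb. Qed.

Lemma confD (a : nat -> nat) m (b b' : nat -> {poly R}) : conf a m (fun t => b t + b' t) = conf a m b + conf a m b'.
Proof. by rewrite -big_split; apply: eq_bigr => i _ /=; rewrite mulrDr. Qed.

Lemma confN (a : nat -> nat) m (b : nat -> {poly R}) : conf a m (fun t => - b t) = - conf a m b.
Proof. by rewrite -sumrN; apply: eq_bigr => i _ /=; rewrite mulrN. Qed.

Lemma confZ (a : nat -> nat) m c (b : nat -> {poly R}) : conf a m (fun t => c *: b t) = c *: conf a m b.
Proof. by rewrite scaler_sumr; apply: eq_bigr => i _ /=; rewrite scalerAr. Qed.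

(** Puts blocks on a common grid of slots, so that configurations with different [tau] can be
    subtracted slot by slot. *)
Lemma conf_reindex (a : nat -> nat) m k (tau : nat -> nat) (b : nat -> {poly R}) :
  (forall i, (i < k)%N -> (tau i < m)%N) ->
  conf a m (fun t => \sum_(i < k | tau i == t) b i) = conf (a \o tau) k b.
Proof.
move=> tm; rewrite /conf; under eq_bigr do rewrite mulr_sumr.
rewrite (exchange_big_dep xpredT)//=; apply: eq_bigr => i _.
by rewrite (big_pred1 (Ordinal (tm i (ltn_ord i)))).
Qed.

End polynomials.

(** * Spreading seminorms and the replacement of blocks *)

Section spreading_seminorm.
Context {R : realType}.
Variable N : {poly R} -> R.
Implicit Types (p q u v b : {poly R}) (a m n T : nat) (eps : R).

(** Spreading is encoded as moving a tail by one place, which [sn_shift] iterates. The abstract [N]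
    covers both the norm of X and the norm [diff_norm] of differences. *)
Definition spreading_seminorm : Prop :=
  [/\ forall p q, N (p + q) <= N p + N q,
      forall c p, N (c *: p) = `|c| * N p
    & forall u v a, (size u <= a)%N -> N (u + 'X^a * v) = N (u + 'X^(a.+1) * v)].

Hypothesis HN : spreading_seminorm.

Let ND p q : N (p + q) <= N p + N q. Proof. by case: HN. Qed.
Let NZ c p : N (c *: p) = `|c| * N p. Proof. by case: HN. Qed.

Lemma sn0 : N 0 = 0. Proof. by rewrite -(scale0r 0) NZ normr0 mul0r. Qed.

Lemma snN p : N (- p) = N p. Proof. by rewrite -scaleN1r NZ normrN1 mul1r. Qed.

Lemma snB p q : N (p - q) <= N p + N q. Proof. by rewrite -(snN q). Qed.

Lemma sn_ge0 p : 0 <= N p.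
Proof.
have := ND p (- p); rewrite subrr sn0 snN -mulr2n pmulrn_lge0//.
Qed.

Lemma snC p q : N (p - q) = N (q - p). Proof. by rewrite -snN opprB. Qed.

Lemma sn_sub_le p q r : N (p - r) <= N (p - q) + N (q - r).
Proof. by rewrite (le_trans _ (ND _ _))// addrA subrK. Qed.

Lemma sn_le_sub p q : N p <= N q + N (p - q).
Proof. by rewrite (le_trans _ (ND _ _))// addrCA subrr addr0. Qed.

Lemma sn_sum (I : Type) (r : seq I) (P : pred I) (F : I -> {poly R}) :
  N (\sum_(i <- r | P i) F i) <= \sum_(i <- r | P i) N (F i).
Proof.
elim/big_rec2: _ => [|i y1 y2 _ h]; first by rewrite sn0.
by rewrite (le_trans (ND _ _))// lerD2l.
Qed.

Lemma sn_shift u v a a' : (size u <= a)%N -> (size u <= a')%N ->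
  N (u + 'X^a * v) = N (u + 'X^a' * v).
Proof.
have key n : (size u <= n)%N -> N (u + 'X^n * v) = N (u + 'X^(size u) * v).
  move=> /subnKC <-; elim: (n - size u)%N => [|k IH]; first by rewrite addn0.
  by rewrite addnS; have [_ _ <-] := HN; rewrite ?leq_addr.
by move=> h h'; rewrite key// [RHS]key.
Qed.

Lemma sn_Xn a v : N ('X^a * v) = N v.
Proof.
have := @sn_shift 0 v a 0; rewrite size_poly0 => /(_ erefl erefl).
by rewrite !add0r expr0 mul1r.
Qed.

Lemma sn_avg_le T b : N (avg T * b) <= N b.
Proof.
rewrite /avg -scalerAl NZ mulr_suml.
have [->|T0] := posnP T; first by rewrite big_ord0 sn0 mulr0 sn_ge0.
rewrite ger0_norm ?invr_ge0// ler_pdivrMl ?ltr0n//.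
rewrite (le_trans (sn_sum _ _ _))//; under eq_bigr do rewrite sn_Xn.
by rewrite sumr_const card_ord mulr_natl.
Qed.

Lemma sn_avg1 T : N (avg T) <= N 1.
Proof. by have := sn_avg_le T 1; rewrite mulr1. Qed.

(* In any successive arrangement of blocks, b may be replaced by b' at cost eps;
   by spreading the widths w and w' of the slots do not matter. *)
Definition dom b b' eps : Prop :=
  forall u v a w w', (size u <= a)%N -> (size b <= w)%N -> (size b' <= w')%N ->
    N (u + 'X^a * b' + 'X^(a + w') * v) <= N (u + 'X^a * b + 'X^(a + w) * v) + eps.

Lemma dom_refl b : dom b b 0.
Proof.
move=> u v a w w' ua bw bw'; rewrite addr0.
by rewrite (@sn_shift (u + 'X^a * b) v (a + w') (a + w))// size_addXn_le.
Qed.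

Lemma dom_trans b b' b'' eps eps' :
  dom b b' eps -> dom b' b'' eps' -> dom b b'' (eps + eps').
Proof.
move=> h h' u v a w w' ua bw bw'.
rewrite (le_trans (h' u v a (size b') w' _ _ _))// addrA lerD2r.
exact: h.
Qed.

Lemma dom_le b b' eps eps' : eps <= eps' -> dom b b' eps -> dom b b' eps'.
Proof.
move=> le h u v a w w' ua bw bw'; apply: (le_trans (h _ _ _ w w' _ _ _)) => //.
by rewrite lerD2l.
Qed.

Lemma dom_triangle b b' : dom b b' (N (b - b')).
Proof.
move=> u v a w w' ua bw bw'.
(* In slots of a common width the two vectors differ by a shift of [b - b']. *)
pose W := maxn w w'.
have E (c : {poly R}) x : (size c <= x)%N -> (size c <= W)%N ->
    N (u + 'X^a * c + 'X^(a + x) * v) = N (u + 'X^a * c + 'X^(a + W) * v).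
  by move=> cx cW; apply: sn_shift; exact: size_addXn_le.
rewrite !E ?(leq_trans bw) ?(leq_trans bw') ?leq_maxl ?leq_maxr//.
rewrite (le_trans (sn_le_sub _ (u + 'X^a * b + 'X^(a + W) * v)))//.
rewrite lerD2l snC -(sn_Xn a (b - b')) le_eqVlt; apply/orP; left; apply/eqP.
by congr N; ring.
Qed.

(* Averaging the shifts of a slot costs nothing, and modulo X - 1 the averaged
   slot only remembers the sum of its coefficients. *)
Lemma dom_avg b : exists2 C, 0 <= C &
  forall T, (0 < T)%N -> dom b (b.[1] *: avg T) (C / T%:R).
Proof.
(* Subtracting the coefficient sum at place 0 leaves a multiple of ['X - 1]; its quotient [q] yields
   the constant [C = 2 N q]. *)
have /root1_factor[q bq] : (b - (b.[1])%:P).[1] = 0.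
  by rewrite hornerD hornerN hornerC subrr.
exists (N q + N q); first by rewrite addr_ge0 ?sn_ge0.
move=> T T0.
have avgb : avg T * b - b.[1] *: avg T = T%:R^-1 *: ('X^T * q - q).
  by rewrite -avgM_subX1 -bq mulrBr [avg T * _%:P]mulrC mul_polyC.
have Nb : N (avg T * b - b.[1] *: avg T) <= (N q + N q) / T%:R.
  rewrite avgb NZ ger0_norm ?invr_ge0// mulrC ler_pM2r ?invr_gt0 ?ltr0n//.
  by rewrite (le_trans (snB _ _))// sn_Xn.
(* In a slot widened by [T], each of the [T] shifts of [b] gives the same norm by spreading, and the
   triangle inequality passes to their mean. *)
have h : dom b (avg T * b) 0.
  move=> u v a w w' ua bw bw'; rewrite addr0.
  pose W := maxn w' (w + T).
  have sb : (size (avg T * b)%R <= W)%N.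
    rewrite (leq_trans bw')// leq_maxl//.
  rewrite (@sn_shift (u + 'X^a * (avg T * b)) v (a + w') (a + W)).
  - set x := N (u + 'X^a * b + _).
    have -> : u + 'X^a * (avg T * b) + 'X^(a + W) * v =
       T%:R^-1 *: \sum_(s < T) (u + 'X^a * ('X^s * b) + 'X^(a + W) * v).
      rewrite !big_split /= !sumr_const card_ord -mulr_sumr -mulr_suml addrAC.
      rewrite -mulrnDl -[(_ + _) *+ T]scaler_nat scalerDr scalerA mulVf ?pnatr_eq0 -?lt0n//.
      by rewrite scale1r /avg -scalerAl -scalerAr addrAC.
    rewrite NZ ger0_norm ?invr_ge0// ler_pdivrMl ?ltr0n//.
    rewrite (le_trans (sn_sum _ _ _))// mulr_natl -[T in x *+ T]card_ord -sumr_const.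
    apply: ler_sum => s _; rewrite /x.
    have sXb : (size ('X^s * b)%R <= w + T)%N.
      rewrite (leq_trans (size_XnMle _ _))// addnC leq_add//.
      exact: ltnW.
    have E1 : N (u + 'X^a * ('X^s * b) + 'X^(a + W) * v) =
              N (u + 'X^a * ('X^s * b) + 'X^(a + (s + w)) * v).
      apply: sn_shift; apply: size_addXn_le => //.
        by rewrite (leq_trans sXb)// leq_maxr.
      by rewrite (leq_trans (size_XnMle _ _))// leq_add2l.
    have E2 (y : {poly R}) : u + 'X^a * ('X^s * b) + 'X^(a + (s + w)) * y =
              u + 'X^(a + s) * (b + 'X^w * y).
      by rewrite mulrDr addrA !mulrA -!exprD addnA.
    have E3 (y : {poly R}) : u + 'X^a * b + 'X^(a + w) * y = u + 'X^a * (b + 'X^w * y).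
      by rewrite mulrDr addrA !mulrA -!exprD.
    rewrite E1 E2 E3 (@sn_shift u _ (a + s) a)//.
    by rewrite (leq_trans ua)// leq_addr.
  - exact: size_addXn_le.
  - exact: size_addXn_le.
rewrite -[X in dom _ _ X]add0r; apply: (dom_trans h); apply: dom_le Nb _.
exact: dom_triangle.
Qed.

Lemma ler_eps_nat (x y C : R) :
  (forall T, (0 < T)%N -> x <= y + C / T%:R) -> x <= y.
Proof.
move=> h; apply/ler_addgt0Pr => eps e0.
have [C0|C0] := leP C 0.
  by rewrite (le_trans (h 1%N isT))// invr1 mulr1 lerD2l (le_trans C0)// ltW.
pose T := (Num.truncn (C / eps)).+1.
have CT : C / T%:R <= eps.
  rewrite ler_pdivrMr ?ltr0n// mulrC -ler_pdivrMr// ltW//.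
  by rewrite truncnS_gt.
by rewrite (le_trans (h T isT))// lerD2l.
Qed.

(** In [dom_avg] the replacing block is then 0, and the error [C / T] vanishes as [T] grows. *)
Lemma dom_zero b : b.[1] = 0 -> dom b 0 0.
Proof.
move=> b1 u v a w w' ua bw bw'; have [C C0 h] := dom_avg b.
rewrite addr0; apply: (@ler_eps_nat _ _ C) => T T0.
have := h T T0; rewrite b1 scale0r; exact.
Qed.

(** A convex combination of keeping the block and deleting it. *)
Lemma dom_shrink b (c : R) : b.[1] = 0 -> 0 <= c <= 1 -> dom b (c *: b) 0.
Proof.
move=> b1 /andP[c0 c1] u v a w w' ua bw bw'; rewrite addr0.
pose W := maxn w w'.
have E (x : {poly R}) y : (size x <= y)%N -> (size x <= W)%N ->
    N (u + 'X^a * x + 'X^(a + y) * v) = N (u + 'X^a * x + 'X^(a + W) * v).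
  by move=> cx cW; apply: sn_shift; exact: size_addXn_le.
rewrite !E ?(leq_trans bw) ?(leq_trans bw') ?leq_maxl ?leq_maxr//.
have -> : u + 'X^a * (c *: b) + 'X^(a + W) * v =
    c *: (u + 'X^a * b + 'X^(a + W) * v) + (1 - c) *: (u + 'X^a * 0 + 'X^(a + W) * v).
  rewrite mulr0 addr0 !scalerDr !scalerBl !scale1r scalerAr.
  by move: (c *: u) (c *: ('X^(a + W) * v)) => x y; ring.
have bW : (size b <= W)%N by rewrite (leq_trans bw)// leq_maxl.
have := @dom_zero b b1 u v a W W ua bW; rewrite size_poly0 => /(_ isT).
rewrite addr0 => h0.
rewrite (le_trans (ND _ _))// !NZ !ger0_norm ?subr_ge0//.
set x := N (u + 'X^a * b + _) in h0 *; set y := N _ in h0 *.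
have : (1 - c) * y <= (1 - c) * x by rewrite ler_wpM2l ?subr_ge0.
lra.
Qed.

(** Correcting one coefficient makes the block zero-sum, after which it is deleted for free; only
    the correction costs. *)
Lemma dom_sum0 b : dom b 0 (`|b.[1]| * N 1).
Proof.
have b0 : (b - (b.[1])%:P).[1] = 0 by rewrite hornerD hornerN hornerC subrr.
have := dom_trans (@dom_triangle b (b - (b.[1])%:P)) (dom_zero b0).
by rewrite addr0 opprB addrC subrK -[_%:P]mulr1 mul_polyC NZ.
Qed.

Lemma dom_norm b b' eps : dom b b' eps -> N b' <= N b + eps.
Proof.
move=> /(_ 0 0 0%N (size b) (size b')); rewrite size_poly0 => /(_ isT).
by rewrite !leqnn !mulr0 !addr0 !add0r expr0 !mul1r => /(_ isT isT).
Qed.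

(** The intermediate configuration is [b'] followed by [c]: [c] belongs to the tail while [b] is
    replaced, and [b'] to the prefix while [c] is replaced. *)
Lemma dom_cat b b' c c' eps eps' w w' : (size b <= w)%N -> (size b' <= w')%N ->
  dom b b' eps -> dom c c' eps' ->
  dom (b + 'X^w * c) (b' + 'X^w' * c') (eps + eps').
Proof.
move=> bw bw' db dc u v a x x' ua sx sx'.
have assoc (y z : {poly R}) n n' : u + 'X^a * (y + 'X^n * z) + 'X^(a + (n + n')) * v =
    (u + 'X^a * y) + 'X^(a + n) * z + 'X^(a + n + n') * v.
  by rewrite mulrDr mulrA -exprD !addrA addnA.
have assoc' (y z : {poly R}) n n' : u + 'X^a * (y + 'X^n * z) + 'X^(a + (n + n')) * v =
    (u + 'X^a * y) + 'X^(a + n) * (z + 'X^n' * v).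
  by rewrite assoc mulrDr mulrA -exprD !addrA.
have E (y z : {poly R}) n n' : (size y <= n)%N -> (size (y + 'X^n * z)%R <= n')%N ->
    N (u + 'X^a * (y + 'X^n * z) + 'X^(a + n') * v) =
    N (u + 'X^a * (y + 'X^n * z) + 'X^(a + (n + size z)) * v).
  move=> yn szn; apply: sn_shift; apply: size_addXn_le => //.
  exact: size_addXn_le.
rewrite !E// assoc assoc'.
have := dc (u + 'X^a * b') v (a + w')%N (size c) (size c').
move=> /(_ (size_addXn_le ua bw') (leqnn _) (leqnn _)) h.
rewrite (le_trans h)// addrA lerD2r.
have := db u (c + 'X^(size c) * v) a w w' ua bw bw'.
by rewrite {1}mulrDr mulrA -exprD !addrA.
Qed.

Lemma dom_conf (a a' : nat -> nat) m (b b' : nat -> {poly R}) (eps : nat -> R) :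
  fits a m b -> fits a' m b' -> (forall t, (t < m)%N -> dom (b t) (b' t) (eps t)) ->
  dom (conf a m b) (conf a' m b') (\sum_(t < m) eps t).
Proof.
elim: m => [|m IH] fa fa' h; first by rewrite !conf0 big_ord0; exact: dom_refl.
have fam : fits a m b by move=> t tm; apply: fa; apply: leq_trans tm _.
have fam' : fits a' m b' by move=> t tm; apply: fa'; apply: leq_trans tm _.
rewrite !confS big_ord_recr/=; apply: dom_cat; [exact: size_conf..| |exact: h].
by apply: IH => // t tm; apply: h; apply: leq_trans tm _.
Qed.

Lemma sn_conf_le (a a' : nat -> nat) m (b b' : nat -> {poly R}) (eps : nat -> R) :
  fits a m b -> fits a' m b' -> (forall t, (t < m)%N -> dom (b t) (b' t) (eps t)) ->
  N (conf a' m b') <= N (conf a m b) + \sum_(t < m) eps t.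
Proof. by move=> fa fa' h; apply/dom_norm/dom_conf. Qed.

Lemma dom_conf_indep (a a' : nat -> nat) m (b : nat -> {poly R}) :
  fits a m b -> fits a' m b -> dom (conf a m b) (conf a' m b) 0.
Proof.
move=> fa fa'; have -> : 0 = \sum_(t < m) 0 :> R by rewrite big1.
by apply: (@dom_conf a a' m b b (fun=> 0)) => // t _; exact: dom_refl.
Qed.

Lemma sn_conf_indep (a a' : nat -> nat) m (b : nat -> {poly R}) :
  fits a m b -> fits a' m b -> N (conf a m b) = N (conf a' m b).
Proof.
move=> fa fa'; apply/eqP; rewrite eq_le.
have h x y : fits x m b -> fits y m b -> N (conf x m b) <= N (conf y m b).
  by move=> fx fy; have := dom_norm (dom_conf_indep fy fx); rewrite addr0.
by rewrite !h.
Qed.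

End spreading_seminorm.

(** * Coefficients, dilations and waves *)

Section coefficients.
Context {R : realType}.
Implicit Types (p q : {poly R}) (F : pred nat) (m n T : nat).

Lemma poly_conf p : p = conf id (size p) (fun t => (p`_t)%:P).
Proof.
rewrite -{1}(coefK p).
rewrite poly_def /conf; apply: eq_bigr => i _.
by rewrite -mul_polyC mulrC.
Qed.

Lemma suppress_conf F p :
  suppress F p = conf id (size p) (fun t => (if F t then p`_t else 0)%:P).
Proof.
rewrite /suppress poly_def /conf; apply: eq_bigr => i _.
by rewrite -mul_polyC mulrC.
Qed.

Lemma comp_Xn_conf p m : p \Po 'X^m = conf (muln^~ m) (size p) (fun t => (p`_t)%:P).
Proof.
rewrite comp_polyE /conf; apply: eq_bigr => i _.
by rewrite -mul_polyC mulrC -exprM mulnC.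
Qed.

Lemma fits_const (a : nat -> nat) n (c : nat -> R) :
  (forall t, (a t < a t.+1)%N) -> fits a n (fun t => (c t)%:P).
Proof.
move=> h t _; rewrite (leq_trans _ (h t))// -addn1 leq_add2l.
exact: size_polyC_leq1.
Qed.

Lemma suppress_horner1 F p : (suppress F p).[1] = \sum_(t < size p) (if F t then p`_t else 0).
Proof.
rewrite /suppress poly_def horner_sum; apply: eq_bigr => i _.
by rewrite hornerZ hornerXn expr1n mulr1.
Qed.

(** Multiplied by ['X - 1], both sides become ['X^(L * m) - 1]. This is division with remainder of
    the exponents by [m], and it presents a long average as a mean of shifts of a dilated short
    one. *)
Lemma sum_Xn_mul L m : \sum_(s < L * m) 'X^s =
  ((\sum_(i < L) 'X^i) \Po 'X^m) * \sum_(r < m) 'X^r :> {poly R}.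
Proof.
have X1 : 'X - 1 != 0 :> {poly R} by rewrite polyXsubC_eq0.
apply: (mulfI X1); rewrite -subrX1 mulrCA -subrX1.
have -> : (\sum_(i < L) 'X^i) \Po 'X^m = \sum_(i < L) 'X^m ^+ i :> {poly R}.
  by rewrite raddf_sum; apply: eq_bigr => i _; rewrite /= comp_Xn_poly.
by rewrite mulrC -subrX1 -exprM mulnC.
Qed.

Lemma avg_mul L m : avg (L * m) = (avg L \Po 'X^m) * avg m :> {poly R}.
Proof.
by rewrite /avg sum_Xn_mul comp_polyZ natrM invfM -scalerAl -scalerAr scalerA mulrC.
Qed.

Definition wave T : {poly R} := avg T - 'X^T * avg T.

Lemma wave_horner1 T : (wave T).[1] = 0.
Proof. by rewrite !hornerE /= expr1n mul1r subrr. Qed.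

Lemma size_wave T : (size (wave T) <= T.*2)%N.
Proof.
rewrite -addnn /wave -mulrN; apply: size_addXn_le; first exact: size_avg.
by rewrite size_polyN size_avg.
Qed.

Lemma wave_comp L m : wave L \Po 'X^m = (avg L \Po 'X^m) - 'X^(L * m) * (avg L \Po 'X^m).
Proof. by rewrite /wave comp_polyB comp_polyM comp_Xn_poly -exprM mulnC. Qed.

End coefficients.
Arguments wave {R} T.

(** * Two conditions that make coordinate suppressions bounded *)

Section unconditionality.
Context {R : realType}.
Variable N : {poly R} -> R.
Hypothesis HN : spreading_seminorm N.
Implicit Types (p q u v b : {poly R}) (F : pred nat) (m n T : nat).

Let ND p q : N (p + q) <= N p + N q. Proof. by case: HN. Qed.
Let NZ c p : N (c *: p) = `|c| * N p. Proof. by case: HN. Qed.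

Lemma sn_polyC (c : R) : N c%:P = `|c| * N 1.
Proof. by rewrite -[c%:P]mulr1 mul_polyC NZ. Qed.

Lemma sn_comp_Xn p m : (0 < m)%N -> N (p \Po 'X^m) = N p.
Proof.
move=> m0; rewrite {2}(poly_conf p) comp_Xn_conf.
by apply: sn_conf_indep => //; apply: fits_const => // t; rewrite ltn_pmul2r.
Qed.

Lemma dom_comp_Xn p m : (0 < m)%N -> dom N (p \Po 'X^m) p 0.
Proof.
move=> m0; rewrite {2}(poly_conf p) comp_Xn_conf.
by apply: dom_conf_indep => //; apply: fits_const => // t; rewrite ltn_pmul2r.
Qed.

(** Some [q'] has sum 1 and norm at most [1/T]. Each one-coefficient block is then within
    [|p_t| / T] of the zero-sum block [p_t (1 - q')], which can be deleted. *)
Lemma sum_unbounded_suppress :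
  (forall B, exists p, B * N p < `|p.[1]|) ->
  forall F p, N (suppress F p) <= N p.
Proof.
move=> h F p; apply: (@ler_eps_nat _ _ _ (\sum_(t < size p) `|p`_t|)) => T T0.
have [q hq] := h T%:R.
have q1 : q.[1] != 0.
  by rewrite -normr_gt0 (le_lt_trans _ hq)// mulr_ge0 ?sn_ge0.
pose q' := (q.[1])^-1 *: q.
have q'1 : q'.[1] = 1 by rewrite hornerZ mulVf.
have Nq' : N q' <= T%:R^-1.
  rewrite NZ normfV ler_pdivrMl ?normr_gt0// -ler_pdivrMr ?invr_gt0 ?ltr0n//.
  by rewrite invrK mulrC ltW.
rewrite suppress_conf [X in _ <= N X + _]poly_conf mulr_suml.
apply: (sn_conf_le HN (eps := fun t => `|p`_t| / T%:R)); [exact: fits_const..|].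
move=> t _; have ge0 : 0 <= `|p`_t| / T%:R by rewrite mulr_ge0 ?invr_ge0.
case: ifP => _; first exact: dom_le ge0 (dom_refl HN (b := _)).
have z : (p`_t *: (1 - q')).[1] = 0.
  by rewrite hornerZ hornerD hornerN hornerC q'1 subrr mulr0.
have := dom_trans (@dom_triangle _ _ HN (p`_t)%:P _) (dom_zero HN z).
apply: dom_le; rewrite addr0 scalerBr -[_%:P]mulr1 mul_polyC opprB addrC subrK.
by rewrite NZ ler_wpM2l.
Qed.

(* The norm of the sequence of differences e_(2i) - e_(2i+1). *)
Definition diff_norm p : R := N ((p \Po 'X^2) * (1 - 'X)).

Lemma size_diff p : (size ((p \Po 'X^2) * (1 - 'X))%R <= (size p).*2)%N.
Proof.
have [->|p0] := eqVneq p 0; first by rewrite comp_poly0 mul0r size_poly0.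
have s1 : (size (1 - 'X : {poly R})%R <= 2)%N.
  by rewrite -opprB size_polyN size_XsubC.
rewrite (leq_trans (size_polyMleq _ _))//.
have := size_comp_poly_leq p 'X^2; rewrite size_polyXn/=.
have : (0 < size p)%N by rewrite size_poly_gt0.
move: s1; move: (size _) (size _) (size _) => x y z; lia.
Qed.

(** Makes [dom_avg] available for the sequence of differences. *)
Lemma diff_spreading : spreading_seminorm diff_norm.
Proof.
split=> [p q|c p|u v a ua].
- by rewrite /diff_norm comp_polyD mulrDl.
- by rewrite /diff_norm comp_polyZ -scalerAl NZ.
- rewrite /diff_norm !comp_polyD !comp_polyM !comp_Xn_poly -!exprM !mulrDl -!mulrA.
  by apply: (sn_shift HN); rewrite (leq_trans (size_diff _))// mul2n leq_double// leqW.
Qed.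

Lemma diff_conf p : (p \Po 'X^2) * (1 - 'X) =
  conf (muln^~ 2) (size p) (fun t => p`_t *: (1 - 'X)).
Proof.
rewrite comp_Xn_conf /conf mulr_suml; apply: eq_bigr => i _.
by rewrite -mulrA mul_polyC.
Qed.

Lemma size_1X : size (1 - 'X : {poly R}) = 2.
Proof. by rewrite -opprB size_polyN size_XsubC. Qed.

Lemma fits_diff n (c : nat -> R) : fits (muln^~ 2)%N n (fun t => c t *: (1 - 'X)).
Proof.
move=> t _; rewrite mulSn addnC leq_add2r (leq_trans (size_scale_leq _ _))//.
by rewrite size_1X.
Qed.

(** The differences are zero-sum blocks, hence deleted for free; the full combination of differences
    is a copy of [p] on the even places minus one on the odd places. *)
Lemma diff_norm_suppress F p : diff_norm (suppress F p) <= N p + N p.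
Proof.
have -> : diff_norm (suppress F p) =
    N (conf (muln^~ 2)%N (size p) (fun t => (if F t then p`_t else 0) *: (1 - 'X))).
  rewrite /diff_norm; congr N; rewrite [suppress F p]suppress_conf /conf.
  rewrite raddf_sum mulr_suml; apply: eq_bigr => i _ /=.
  by rewrite comp_polyM comp_polyC comp_Xn_poly -exprM mulnC -mulrA mul_polyC.
have h : forall t, (t < size p)%N ->
    dom N (p`_t *: (1 - 'X)) ((if F t then p`_t else 0) *: (1 - 'X)) 0.
  move=> t _; case: ifP => _; first exact: dom_refl.
  by rewrite scale0r; apply: dom_zero => //; rewrite !hornerE subrr mulr0.
rewrite (le_trans (sn_conf_le HN (fits_diff _) (fits_diff _) h))// big1// addr0.
rewrite -diff_conf mulrDr mulr1 mulrN (le_trans (snB HN _ _))//.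
by rewrite [_ * 'X]mulrC -{2}(expr1 'X) (sn_Xn HN) sn_comp_Xn.
Qed.

(** Under the lower bound, [N] dominates the l_1 norm. Averaging the nonnegative part of [p] in
    [diff_norm] bounds its sum by [2 / d * N p]; the same holds for the negative part, and any
    suppression is at most [N 1] times the l_1 norm. *)
Lemma diff_lower_suppress (d : R) : 0 < d ->
  (forall T, (0 < T)%N -> d <= diff_norm (avg T)) ->
  exists C, forall F p, N (suppress F p) <= C * N p.
Proof.
move=> d0 hd.
have pos F p : (forall t, F t -> 0 <= p`_t) ->
    (suppress F p).[1] <= 2 / d * N p.
  move=> Fp; set q := suppress F p.
  have q0 : 0 <= q.[1].
    rewrite suppress_horner1 sumr_ge0// => i _; case: ifP => // /Fp; exact.
  have [C C0 hC] := dom_avg diff_spreading q.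
  have h : q.[1] * d <= diff_norm q.
    apply: (@ler_eps_nat _ _ _ C) => T T0.
    rewrite (le_trans _ (dom_norm (hC T T0)))//.
    have [_ -> _] := diff_spreading; rewrite ger0_norm// ler_wpM2l// hd//.
  rewrite mulrAC ler_pdivlMr// (le_trans h)// (le_trans (diff_norm_suppress _ _))//.
  by rewrite mulr_natl mulr2n.
exists (4 / d * N 1) => F p.
have l1 : \sum_(t < size p) `|p`_t| <= 4 / d * N p.
  have h1 := pos (fun t => 0 <= p`_t) p (fun t => id).
  have h2 := pos (fun t => (- p)`_t > 0) (- p) (fun t => @ltW _ _ _ _).
  rewrite (snN HN) !suppress_horner1 size_polyN in h1 h2.
  have := lerD h1 h2; rewrite -big_split/=.
  under eq_bigr => t _.
    have -> : (if 0 <= p`_t then p`_t else 0) +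
              (if 0 < (- p)`_t then (- p)`_t else 0) = `|p`_t|.
      rewrite coefN oppr_gt0; case: (leP 0 p`_t) => pt.
        by rewrite addr0 ger0_norm.
      by rewrite add0r ltr0_norm.
    over.
  by move=> /le_trans; apply; lra.
rewrite suppress_conf /conf (le_trans (sn_sum HN _ _ _))//.
rewrite mulrAC; apply: le_trans (ler_wpM2r (sn_ge0 HN 1) l1).
rewrite mulr_suml; apply: ler_sum => t _; rewrite (sn_Xn HN) sn_polyC.
by rewrite ler_wpM2r ?(sn_ge0 HN)//; case: ifP => // _; rewrite normr0.
Qed.

Lemma dom_binomial r r' : (r < r')%N -> dom N (1 - 'X) ('X^r - 'X^r') 0.
Proof.
move=> rr.
have -> : 1 - 'X = conf id 2 (fun t => (if t == 0%N then 1 else -1)%:P) :> {poly R}.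
  by rewrite /conf !big_ord_recl big_ord0/= addr0 expr0 expr1 mulr1 polyCN mulrN1.
(* The default value [r'.+1] of [nth] is the end of the second slot. *)
have -> : 'X^r - 'X^r' = conf (fun t => nth (r'.+1) [:: r; r'] t) 2
    (fun t => (if t == 0%N then 1 else -1)%:P) :> {poly R}.
  by rewrite /conf !big_ord_recl big_ord0/= addr0 mulr1 polyCN mulrN1.
apply: dom_conf_indep => //; first exact: fits_const.
move=> t t2; case: t t2 => [|[|]]//= _; rewrite ?size_polyN size_polyC;
  by case: (_ == _); rewrite ?addn0 ?addn1// ltnW.
Qed.

(** By [avg_mul] the long average is a mean of shifts by [r < m] of the dilated [avg L]. A shifted
    copy differs from the unshifted one by an average of [L] successive differences, of norm at most
    [diff_norm (avg L)] by spreading. *)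
Lemma avg_mul_near L m : (0 < m)%N ->
  N (avg (L * m) - (avg L \Po 'X^m)) <= diff_norm (avg L).
Proof.
move=> m0.
have shiftle r r' : (r < m)%N -> (r' < m)%N ->
    N ((avg L \Po 'X^m) * ('X^r - 'X^r')) <= diff_norm (avg L).
  wlog rr : r r' / (r <= r')%N.
    move=> W rm r'm; have [rr|/ltnW rr] := leqP r r'; first exact: W.
    by rewrite -opprB mulrN (snN HN) W.
  move=> rm r'm; move: rr; rewrite leq_eqVlt => /predU1P[->|rr].
    by rewrite subrr mulr0 (sn0 HN) (sn_ge0 diff_spreading).
  have c0 : 0 <= L%:R^-1 :> R by rewrite invr_ge0.
  have -> : (avg L \Po 'X^m) * ('X^r - 'X^r') =
      conf (muln^~ m) L (fun=> L%:R^-1 *: ('X^r - 'X^r')) :> {poly R}.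
    rewrite /avg comp_polyZ raddf_sum/= -scalerAl mulr_suml scaler_sumr.
    apply: eq_bigr => i _; rewrite comp_Xn_poly -exprM mulnC scalerAr//.
  have -> : diff_norm (avg L) =
      N (conf (muln^~ 2)%N L (fun=> L%:R^-1 *: (1 - 'X))).
    rewrite /diff_norm /avg comp_polyZ raddf_sum/= -scalerAl mulr_suml scaler_sumr.
    by congr N; apply: eq_bigr => i _; rewrite comp_Xn_poly -exprM mulnC scalerAr.
  rewrite !confZ !NZ ler_wpM2l//.
  have := @sn_conf_le _ _ HN (muln^~ 2)%N (muln^~ m) L (fun=> 1 - 'X)
    (fun=> 'X^r - 'X^r') (fun=> 0); rewrite big1// addr0; apply.
  - by move=> t _; rewrite mulSn addnC leq_add2r size_1X.
  - move=> t _; rewrite mulSn addnC leq_add2r (leq_trans (size_polyD _ _))//.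
    by rewrite size_polyN !size_polyXn geq_max rm.
  - by move=> t _; exact: dom_binomial.
rewrite avg_mul {1}/avg -scalerAr.
have -> : m%:R^-1 *: ((avg L \Po 'X^m) * \sum_(s < m) 'X^s) - (avg L \Po 'X^m) =
   m%:R^-1 *: \sum_(s < m) ((avg L \Po 'X^m) * ('X^s - 'X^0)) :> {poly R}.
  rewrite -mulr_sumr.
  have mE : (avg L \Po 'X^m) = (m%:R : R)^-1 *: ((avg L \Po 'X^m) *+ m) :> {poly R}.
    by rewrite -[(_ \Po _) *+ m]scaler_nat scalerA mulVf ?scale1r// pnatr_eq0 -lt0n.
  rewrite [X in _ - X]mE -scalerBr; congr (_ *: _).
  by rewrite sumrB sumr_const card_ord expr0 mulrBr mulrnAr mulr1.
rewrite NZ ger0_norm ?invr_ge0// ler_pdivrMl ?ltr0n// mulr_natl.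
rewrite (le_trans (sn_sum HN _ _ _))// -[X in _ *+ X](card_ord m) -sumr_const.
by apply: ler_sum => s _; apply: shiftle.
Qed.

(** The long wave is close to the dilation of [wave L] by [m], and undoing a dilation is free. *)
Lemma dom_wave L m : (0 < m)%N ->
  dom N (wave (L * m)) (wave L) (diff_norm (avg L) + diff_norm (avg L)).
Proof.
move=> m0.
have := dom_trans (@dom_triangle _ _ HN (wave (L * m)) _) (@dom_comp_Xn (wave L) m m0).
rewrite addr0; apply: dom_le; rewrite wave_comp /wave.
set x := avg _; set y := _ \Po _.
have -> : x - 'X^(L * m) * x - (y - 'X^(L * m) * y) = (x - y) - 'X^(L * m) * (x - y).
  by ring.
rewrite (le_trans (snB HN _ _))// (sn_Xn HN).
by rewrite lerD// avg_mul_near.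
Qed.

End unconditionality.

(** * The seminorm induced by a sequence of vectors *)

Section vectors.
Context {R : realType} {X : normedModType R}.
Variable e : nat -> X.
Implicit Types (p q u v : {poly R}) (F : pred nat).

Definition vec p : X := \sum_(i < size p) p`_i *: e i.

Lemma vec_wide n p : (size p <= n)%N -> vec p = \sum_(i < n) p`_i *: e i.
Proof.
move=> pn; rewrite /vec (big_ord_widen n (fun i => p`_i *: e i) pn) big_mkcond.
apply: eq_bigr => i _; case: ltnP => // pi.
by rewrite nth_default// scale0r.
Qed.

Lemma vec_poly n (a : nat -> R) : vec (\poly_(i < n) a i) = \sum_(i < n) a i *: e i.
Proof.
rewrite (vec_wide (size_poly _ _)); apply: eq_bigr => i _.
by rewrite coef_poly ltn_ord.
Qed.

Lemma vecD p q : vec (p + q) = vec p + vec q.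
Proof.
pose n := maxn (size p) (size q).
rewrite (@vec_wide n)//; last exact: size_polyD.
rewrite (@vec_wide n p) ?leq_maxl// (@vec_wide n q) ?leq_maxr//.
by rewrite -big_split; apply: eq_bigr => i _; rewrite coefD scalerDl.
Qed.

Lemma vecZ c p : vec (c *: p) = c *: vec p.
Proof.
rewrite (@vec_wide (size p)) ?size_scale_leq// /vec scaler_sumr.
by apply: eq_bigr => i _; rewrite coefZ scalerA.
Qed.

Lemma vecB p q : vec (p - q) = vec p - vec q.
Proof. by rewrite vecD -scaleN1r vecZ scaleN1r. Qed.

Lemma vec_Xn a p : vec ('X^a * p) = \sum_(i < size p) p`_i *: e (a + i)%N.
Proof.
rewrite (@vec_wide (a + size p)) ?size_XnMle//.
rewrite big_split_ord/= [X in X + _]big1 ?add0r => [|i _]; last first.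
  by rewrite coefXnM ltn_ord scale0r.
by apply: eq_bigr => i _; rewrite coefXnM ltnNge leq_addr/= addKn.
Qed.

Definition vnorm p : R := `|vec p|.

Lemma vnorm_spreading : spreading e -> spreading_seminorm vnorm.
Proof.
move=> spr; split=> [p q|c p|u v a ua]; rewrite /vnorm.
- by rewrite vecD ler_normD.
- by rewrite vecZ normrZ.
rewrite !vecD !vec_Xn (vec_wide ua).
(* [c] lists the coefficients of [u] and then those of [v]; [h] is the increasing map that omits
   [a], so it moves exactly the tail. *)
pose c i := if (i < a)%N then u`_i else v`_(i - a).
pose h i := if (i < a)%N then i else i.+1.
have hh : {homo h : i j / (i < j)%N}.
  by move=> i j; rewrite /h; case: (ltnP i a); case: (ltnP j a); lia.
have := spr c (a + size v)%N h hh.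
rewrite !big_split_ord/= => E; rewrite -[LHS]/(`|_ + _|).
under eq_bigr => i _.
  have -> : u`_i = c i by rewrite /c ltn_ord.
  over.
under [X in _ + X]eq_bigr => i _.
  have -> : v`_i = c (a + i)%N by rewrite /c ltnNge leq_addr/= addKn.
  over.
rewrite E; congr (`|_ + _|); apply: eq_bigr => i _.
  by rewrite /h /c ltn_ord.
by rewrite /h /c ltnNge leq_addr/= addKn addSn.
Qed.

End vectors.

Local Open Scope classical_set_scope.

(** * Bounded suppressions imply unconditionality *)

Section schauder.
Context {R : realType} {X : completeNormedModType R}.
Variable e : nat -> X.
Hypothesis Ee : schauder_basis e.
Implicit Types (p q u v : {poly R}) (F : pred nat).
Local Notation N := (vnorm e).

Lemma series_vec (a : nat -> R) :
  series (fun i => a i *: e i) = (fun n => vec e (\poly_(i < n) a i)).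
Proof. by apply/funext => n; rewrite vec_poly /series/= big_mkord. Qed.

Lemma cvg_vec_poly p : series (fun i => p`_i *: e i) @ \oo --> vec e p.
Proof.
rewrite series_vec; apply: cvg_near_cst; near=> n.
have pn : (size p <= n)%N by near: n; exact: nbhs_infty_ge.
by rewrite vec_poly (vec_wide e pn).
Unshelve. all: by end_near. Qed.

Lemma vec_inj p : vec e p = 0 -> p = 0.
Proof.
move=> p0; have [a [_ ua]] := Ee 0.
have h1 : a = (fun i => p`_i) by apply: ua; rewrite -p0; exact: cvg_vec_poly.
have h2 : a = (fun i => (0 : {poly R})`_i).
  apply: ua; have <- : vec e 0 = 0 by rewrite /vec size_poly0 big_ord0.
  exact: cvg_vec_poly.
by apply/polyP => i; move: h2; rewrite h1 => /(congr1 (@^~ i)).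
Qed.

Lemma vnorm_gt0 p : p != 0 -> 0 < N p.
Proof. by move=> p0; rewrite normr_gt0; apply: contra_neq p0; exact: vec_inj. Qed.

(** A far block of the rearranged series is a suppression of a far block of the original one, so the
    Cauchy criterion is inherited. *)
Lemma suppress_unconditional C :
  (forall F p, N (suppress F p) <= C * N p) -> unconditional e.
Proof.
move=> hC a /cauchy_cvgP/cauchy_seriesP ca s [s' sK s'K].
apply/cauchy_cvgP/cauchy_seriesP => eps eps0.
have C1 : 0 < `|C| + 1 by rewrite ltr_wpDl.
have /ca : 0 < eps / (`|C| + 1) by rewrite divr_gt0.
move=> [[P Q] [/= [n0 _ hP] [n1 _ hQ]] h].
pose n2 := maxn n0 n1.
(* Past [m0] the rearrangement no longer takes values below [n2]. *)
pose m0 := (\max_(i < n2) (s' i)).+1.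
have big k : (m0 <= k)%N -> (n2 <= s k)%N.
  move=> mk; rewrite leqNgt; apply/negP => sk.
  have := @leq_bigmax _ (fun i : 'I_n2 => s' i) (Ordinal sk).
  by rewrite /= sK leqNgt; move: mk; rewrite /m0 => ->.
have key m n : (m0 <= m)%N ->
    `|\sum_(m <= k < n) a (s k) *: e (s k)| < eps.
  move=> mm; pose M := (n2 + \max_(m <= k < n) s k).+1.
  pose F i := i \in map s (index_iota m n).
  have FM i : F i -> (n2 <= i < M)%N.
    move=> /mapP[k]; rewrite mem_index_iota => /andP[mk kn] ->.
    rewrite big ?(leq_trans mm)//= /M ltnS (leq_trans _ (leq_addl _ _))//.
    by apply: (@leq_bigmax_seq _ _ _ s k) => //; rewrite mem_index_iota mk.
  pose q := \poly_(i < M) (if (n2 <= i)%N then a i else 0).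
  have -> : \sum_(m <= k < n) a (s k) *: e (s k) = vec e (suppress F q).
    rewrite (@vec_wide _ _ _ M); last first.
      by rewrite (leq_trans (size_poly _ _))// size_poly.
    rewrite -(big_map s xpredT (fun i => a i *: e i)).
    have pe : perm_eq (map s (index_iota m n)) [seq i <- iota 0 M | F i].
      apply: uniq_perm.
      - by rewrite map_inj_uniq ?iota_uniq//; exact: can_inj sK.
      - by rewrite filter_uniq// iota_uniq.
      - move=> i; rewrite mem_filter mem_iota add0n /=.
        rewrite -/(F i); case Fi: (F i) => //=.
        by have /andP[_ ->] := FM i Fi.
    rewrite (perm_big _ pe) big_filter -/(index_iota 0 M) -(subn0 M) -/(index_iota 0 M).
    rewrite big_mkord big_mkcond; apply: eq_bigr => i _.
    have iM : (i < M)%N by rewrite (leq_trans (ltn_ord i))// subn0.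
    rewrite /suppress coef_poly; case: ifP => Fi; last by rewrite if_same scale0r.
    have /andP[n2i _] := FM i Fi.
    case: ltnP => [_|qi]; first by rewrite coef_poly iM n2i.
    by have := nth_default 0 qi; rewrite coef_poly iM n2i => ->.
  rewrite (le_lt_trans (hC F q))//.
  have Nq : N q < eps / (`|C| + 1).
    have := h (n2, M); rewrite /vnorm vec_poly => hh.
    suff -> : \sum_(i < M) (if (n2 <= i)%N then a i else 0) *: e i =
      \sum_(n2 <= k < M) a k *: e k.
      apply: hh; split => /=; [apply: hP|apply: hQ] => /=.
        exact: leq_maxl.
      rewrite /M (leq_trans _ (leqnSn _))// (leq_trans _ (leq_addr _ _))//.
      exact: leq_maxr.
    rewrite -(big_mkord xpredT (fun i => (if (n2 <= i)%N then a i else 0) *: e i)).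
    rewrite (@big_cat_nat _ _ _ n2)//=; last by rewrite /M ltnW// ltnS leq_addr.
    rewrite big_nat big1 ?add0r => [|i /andP[_]]; last first.
      by rewrite ltnNge => /negbTE ->; rewrite scale0r.
    by apply: eq_big_nat => i /andP[->].
  have C0 : C * N q <= `|C| * N q by rewrite ler_wpM2r ?ler_norm// normr_ge0.
  rewrite (le_lt_trans C0)//.
  have [->|Cn0] := eqVneq C 0; first by rewrite normr0 mul0r.
  rewrite (@lt_le_trans _ _ (`|C| * (eps / (`|C| + 1))))// ?ltr_pM2l ?normr_gt0//.
  rewrite mulrCA ger_pMr// ler_pdivrMr// mul1r lerDl ler01//.
exists ([set m | (m0 <= m)%N], setT) => /=.
  by split => //; [exists m0|exact: filterT].
by move=> [m n] [/= mm _]; exact: key.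
Qed.

End schauder.

Lemma ex_invS_lt (R : realType) (n : nat) (eps : R) : 0 < eps ->
  exists k, k.+1%:R^-1 *+ n < eps.
Proof.
move=> eps0; exists (Num.truncn (n%:R / eps)).
by rewrite -[_ *+ n]mulr_natl ltr_pdivrMr ?ltr0n// mulrC -ltr_pdivrMr// truncnS_gt.
Qed.

(** * Quantitative consequences of conditionality *)

Section conditional.
Context {R : realType} {X : completeNormedModType R}.
Variable e : nat -> X.
Hypothesis Ce : conditional_spreading_basis e.
Implicit Types (p q u v : {poly R}).
Local Notation N := (vnorm e).

Let Ee : schauder_basis e. Proof. by case: Ce. Qed.

Lemma cond_spreading : spreading_seminorm N.
Proof. by case: Ce => _ /vnorm_spreading. Qed.
Let HN := cond_spreading.

Let nunc : ~ unconditional e. Proof. by case: Ce. Qed.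

Lemma cond_sum_bounded : exists2 B, 0 < B & forall p, `|p.[1]| <= B * N p.
Proof.
apply: contrapT => nB; apply: nunc; apply: (@suppress_unconditional _ _ e 1) => F p.
rewrite mul1r; apply: (sum_unbounded_suppress HN) => B.
apply: contrapT => nq; apply: nB; exists (`|B| + 1) => [|q].
  by rewrite ltr_wpDl.
rewrite leNgt; apply/negP => lt; apply: nq; exists q; apply: le_lt_trans lt.
rewrite ler_wpM2r ?normr_ge0// (le_trans (ler_norm _))// lerDl ler01//.
Qed.

Lemma cond_diff_small (d : R) : 0 < d ->
  exists2 L, (0 < L)%N & diff_norm N (avg L) < d.
Proof.
move=> d0; apply: contrapT => nL; apply: nunc.
have [C hC] : exists C, forall F p, N (suppress F p) <= C * N p.
  apply: (diff_lower_suppress HN d0) => T T0; rewrite leNgt.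
  by apply/negP => lt; apply: nL; exists T.
exact: suppress_unconditional hC.
Qed.

Let NZ c p : N (c *: p) = `|c| * N p. Proof. by case: HN. Qed.

Lemma avg_mulr m T : avg (m * T) = m%:R^-1 *: \sum_(r < m) ('X^(r * T) * avg T) :> {poly R}.
Proof.
rewrite avg_mul {1}/avg comp_polyZ raddf_sum/= -scalerAl mulr_suml.
by congr (_ *: _); apply: eq_bigr => i _; rewrite comp_Xn_poly -exprM mulnC.
Qed.

Lemma sn_mean m (F : nat -> {poly R}) c : (0 < m)%N ->
  (forall r, (r < m)%N -> N (F r) <= c) -> N (m%:R^-1 *: \sum_(r < m) F r) <= c.
Proof.
move=> m0 h; rewrite NZ ger0_norm ?invr_ge0// ler_pdivrMl ?ltr0n// mulr_natl.
rewrite (le_trans (sn_sum HN _ _ _))// -[X in _ *+ X](card_ord m) -sumr_const.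
by apply: ler_sum => r _; exact: h.
Qed.

Lemma mean_cst m p : (0 < m)%N -> p = m%:R^-1 *: \sum_(r < m) p.
Proof.
move=> m0; rewrite sumr_const card_ord -[p *+ m]scaler_nat scalerA mulVf ?scale1r//.
by rewrite pnatr_eq0 -lt0n.
Qed.

Lemma wave_shift r r' T : (r + T <= r')%N ->
  N ('X^r * avg T - 'X^r' * avg T) = N (wave T).
Proof.
move=> rr; rewrite -(subnKC rr) -addnA exprD -mulrA -mulrBr (sn_Xn HN) /wave.
rewrite -!mulrN; apply: (sn_shift HN); rewrite ?(leq_trans (size_avg _))//.
exact: leq_addr.
Qed.

(** Cut into pieces of length [T], the long wave is a mean of [m] differences of disjoint translates
    of [avg T], each with the norm of [wave T]. *)
Lemma wave_mul m T : (0 < m)%N -> N (wave (m * T)) <= N (wave T).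
Proof.
move=> m0; rewrite {1}/wave avg_mulr -scalerAr mulr_sumr -scalerBr -sumrB.
apply: (@sn_mean m (fun r => 'X^(r * T) * avg T - 'X^(m * T) * ('X^(r * T) * avg T))) => //.
move=> r rm; rewrite mulrA -exprD wave_shift// addnC leq_add2r.
by rewrite leq_pmull.
Qed.

Lemma wave_near m T r r' : (0 < m)%N ->
  N ('X^r * avg T - 'X^r' * avg (m * T)) <= N (wave T) *+ 2.
Proof.
move=> m0.
have far s s' : (s + T <= s')%N ->
    N ('X^s * avg T - 'X^s' * avg (m * T)) <= N (wave T).
  move=> ss.
  have -> : 'X^s' * avg (m * T) =
      m%:R^-1 *: \sum_(i < m) 'X^s' * ('X^(i * T) * avg T) :> {poly R}.
    by rewrite avg_mulr -scalerAr mulr_sumr.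
  rewrite (mean_cst ('X^s * avg T) m0) -scalerBr -sumrB.
  apply: (@sn_mean m (fun i => 'X^s * avg T - 'X^s' * ('X^(i * T) * avg T))) => // i _.
  by rewrite mulrA -exprD wave_shift// (leq_trans ss)// leq_addr.
(* Both averages are compared with a copy of the long one placed to the right of everything. *)
pose s := (r + r' + T + m * T)%N.
rewrite (le_trans (sn_sub_le HN _ ('X^s * avg (m * T)) _))// mulr2n lerD//.
  by apply: far; rewrite /s; lia.
rewrite (snC HN) wave_shift ?wave_mul//; rewrite /s; lia.
Qed.

(* Otherwise the averages converge to a vector x that all far spreads of its own
   basis expansion approximate, which forces e_i = e_(i+1). *)
Lemma wave_lower : exists2 d, 0 < d & forall T, (0 < T)%N -> d <= N (wave T).
Proof.
apply: contrapT => nd.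
have small (d : R) : 0 < d -> exists T, (0 < T)%N /\ N (wave T) < d.
  move=> d0; apply: contrapT => nT; apply: nd; exists d => // T T0.
  by rewrite leNgt; apply/negP => lt; apply: nT; exists T.
have inv0 k : 0 < k.+1%:R^-1 :> R by rewrite invr_gt0.
have /choice[t ht] := fun k => small _ (inv0 k).
(* Products make each length divide the later ones, so [wave_near] compares any two; the factor
   [t k] keeps [wave (T k)] small. *)
pose T k := (\prod_(i < k.+1) t i)%N.
have TS k : T k.+1 = (t k.+1 * T k)%N by rewrite /T big_ord_recr/= mulnC.
have T0 k : (0 < T k)%N by rewrite prodn_gt0// => i; case: (ht i).
have Tdvd k j : (k <= j)%N -> exists2 m, (0 < m)%N & T j = (m * T k)%N.
  elim: j => [|j IH]; first by rewrite leqn0 => /eqP ->; exists 1%N; rewrite ?mul1n.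
  rewrite leq_eqVlt => /predU1P[->|]; first by exists 1%N; rewrite ?mul1n.
  rewrite ltnS => /IH[m m0 E]; exists (t j.+1 * m)%N; last by rewrite TS E mulnA.
  by rewrite muln_gt0 m0; case: (ht j.+1) => ->.
have NT k : N (wave (T k)) <= k.+1%:R^-1.
  have -> : T k = ((\prod_(i < k) t i) * t k)%N by rewrite /T big_ord_recr.
  rewrite (le_trans (wave_mul _ _)) ?ltW//; last by case: (ht k).
  by rewrite prodn_gt0// => i; case: (ht i).
have NTT k j r r' : (k <= j)%N ->
    N ('X^r * avg (T k) - 'X^r' * avg (T j)) <= k.+1%:R^-1 *+ 2.
  by move=> /Tdvd[m m0 ->]; rewrite (le_trans (wave_near _ _ _ _))// lerMn2r NT.
have [x hx] : exists x : X, forall k r, `|vec e ('X^r * avg (T k)) - x| <= k.+1%:R^-1 *+ 2.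
  pose y k := vec e ('X^0 * avg (T k)).
  have : cvgn y.
    apply/cauchy_cvgP/cauchy_exP => eps eps0.
    have [k hk] := @ex_invS_lt R 2 _ eps0.
    exists (y k), k => //= j kj; rewrite -ball_normE/=.
    by rewrite /y -vecB; apply: le_lt_trans hk; exact: NTT.
  move=> /cvg_ex[x yx]; exists x => k r.
  have cz : (fun j => `|vec e ('X^r * avg (T k)) - y j|) @ \oo -->
      `|vec e ('X^r * avg (T k)) - x|.
    by apply: cvg_norm; apply: cvgB => //; exact: cvg_cst.
  rewrite -(cvg_lim _ cz)//; apply: limr_le; first by apply/cvg_ex; eexists; exact: cz.
  by exists k => //= j kj; rewrite /y -vecB NTT.
have [a [ax _]] := Ee x.
rewrite series_vec in ax; pose s n := \poly_(i < n) a i.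
have [B B0 hB] := cond_sum_bounded.
have near_s (eps : R) : 0 < eps -> exists2 n0, True & forall n, (n0 <= n)%N ->
    exists k, forall r, N (s n - 'X^r * avg (T k)) <= eps.
  move=> eps0; have eps2 : 0 < eps / 2 by rewrite divr_gt0.
  have /cvgrPdist_le/(_ _ eps2)[n0 _ hn0] := ax.
  exists n0 => // n nn0.
  have [k hk] := @ex_invS_lt R 2 _ eps2; exists k => r; rewrite /vnorm vecB.
  have -> : vec e (s n) - vec e ('X^r * avg (T k)) =
    (vec e (s n) - x) - (vec e ('X^r * avg (T k)) - x).
    by rewrite opprB addrA subrK.
  rewrite (le_trans (ler_normB _ _))// [leRHS](splitr eps) lerD//.
    by rewrite distrC; exact: hn0.
  by rewrite (le_trans (hx _ _))// ltW.
(* If [x] were 0, averages would have arbitrarily small norm although their sum is 1, against the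
   bounded summing functional. *)
have [i0 ai0] : exists i0, a i0 != 0.
  apply: contrapT => na.
  have s0 n : s n = 0.
    apply/polyP => i; rewrite coef_poly coef0; case: ifP => // _.
    by apply/eqP; apply: contrapT => /negP ai; apply: na; exists i.
  have eps0 : 0 < B^-1 / 2 by rewrite divr_gt0 ?invr_gt0.
  have [n0 _ /(_ n0 (leqnn _))[k /(_ 0%N)]] := near_s _ eps0.
  rewrite s0 sub0r (snN HN) expr0 mul1r.
  have := hB (avg (T k)); rewrite avg_horner1// normr1 mulrC -ler_pdivrMr// mul1r.
  by move=> /le_trans/[apply]; rewrite leNgt ltr_pdivrMr// ltr_pMr ?invr_gt0// ltr1n.
have N1X : 0 < N (1 - 'X).
  by apply: vnorm_gt0 => //; rewrite -size_poly_gt0 size_1X.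
pose eps := `|a i0| * N (1 - 'X) / 4.
have eps0 : 0 < eps by rewrite divr_gt0// mulr_gt0// normr_gt0.
have [n0 _ hn0] := near_s _ eps0.
pose n := (n0 + i0).+1.
have [k hk] := hn0 n (leq_trans (leq_addr i0 n0) (leqnSn _)).
pose u := take_poly i0 (s n); pose v := drop_poly i0.+1 (s n).
have sE : s n = u + 'X^i0 * ((a i0)%:P + 'X^1 * v).
  apply/polyP => i; rewrite coefD coefXnM coef_take_poly.
  case: ltnP => ii; first by rewrite addr0.
  rewrite add0r coefD coefXnM coefC coef_drop_poly.
  case: (posnP (i - i0)) => [ii0|ii0].
    have -> : i = i0 by apply/eqP; rewrite eqn_leq ii andbT -subn_eq0 ii0.
    by rewrite subnn addr0 coef_poly /n ltnS leq_addl.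
  rewrite add0r ltnNge ii0/= (_ : _ - _ - 1 + _ = i)%N//; lia.
(* With the average placed after [i0], the vector [u + a_i0 e_i0 + w] is small. It stays small when
   [w] alone moves one place and when [w] and the coefficient at [i0] both move; subtracting leaves
   [a_i0 (e_i0 - e_(i0+1))], of norm [4 eps], bounded by [2 eps]. *)
pose w := v - avg (T k).
have h1 : N (u + 'X^i0 * ((a i0)%:P + 'X^1 * w)) <= eps.
  have := hk i0.+1; rewrite sE; congr (_ <= _); congr N.
  by rewrite /w expr1 exprS; ring.
clearbody w; have su : (size u <= i0)%N by exact: size_take_poly.
have sa : (size ((a i0)%:P) <= 1)%N by exact: size_polyC_leq1.
have h2 : N (u + 'X^i0 * ((a i0)%:P + 'X^2 * w)) <= eps.
  have E j : u + 'X^i0 * ((a i0)%:P + 'X^j * w) = u + 'X^i0 * (a i0)%:P + 'X^(i0 + j) * w.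
    by rewrite exprD; ring.
  rewrite E (@sn_shift _ _ HN _ _ _ (i0 + 1)%N) -?E//; last exact: size_addXn_le.
  by rewrite (leq_trans (size_addXn_le su sa))// leq_add2l.
have h3 : N (u + 'X^(i0.+1) * ((a i0)%:P + 'X^1 * w)) <= eps.
  by rewrite (le_trans _ h1)// (@sn_shift _ _ HN _ _ _ i0)// (leq_trans su).
have := le_trans (snB HN _ _) (lerD h2 h3).
have -> : u + 'X^i0 * ((a i0)%:P + 'X^2 * w) - (u + 'X^(i0.+1) * ((a i0)%:P + 'X^1 * w)) =
   'X^i0 * (a i0 *: (1 - 'X)).
  by rewrite -mul_polyC (exprS _ i0) expr1 expr2; ring.
rewrite (sn_Xn HN) NZ /eps -mulrDr.
by have : 0 < `|a i0| * N (1 - 'X) by [rewrite mulr_gt0// normr_gt0]; lra.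
Qed.

Lemma take_polyK a p : p = take_poly a p + 'X^a * drop_poly a p.
Proof. by rewrite mulrC poly_take_drop. Qed.

(** The tail [v] can be deleted once its sum is controlled. Averaging both halves of [p] gives
    [u(1)] and [v(1)] times successive averages; comparing with [p(1)] times the first average
    isolates [v(1) wave T], and waves are bounded below. *)
Lemma cond_basis_constant : exists2 K, 0 < K & forall p a, N (take_poly a p) <= K * N p.
Proof.
have [B B0 hB] := cond_sum_bounded; have [d d0 hd] := wave_lower.
pose K' := (B * N 1 + 1) / d.
have K'0 : 0 < K' by rewrite divr_gt0// ltr_wpDl// mulr_ge0 ?normr_ge0// ltW.
exists (1 + K' * N 1) => [|p a]; first by rewrite ltr_pwDl// mulr_ge0 ?normr_ge0// ltW.
set u := take_poly a p; set v := drop_poly a p.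
have su : (size u <= a)%N by exact: size_take_poly.
have pE : p = u + 'X^a * v by exact: take_polyK.
have tail : `|v.[1]| <= K' * N p.
  rewrite /K' mulrAC ler_pdivlMr// mulrDl mul1r.
  have [Cu _ hu] := dom_avg HN u; have [Cv _ hv] := dom_avg HN v.
  apply: (@ler_eps_nat _ _ _ (Cu + Cv)) => T T0.
  have sT (c : R) : (size (c *: avg T) <= T)%N.
    by rewrite (leq_trans (size_scale_leq _ _))// size_avg.
  have := dom_norm (dom_cat HN su (sT u.[1]) (hu _ T0) (hv _ T0)).
  rewrite -pE -mulrDl => h.
  rewrite (@le_trans _ _ (`|v.[1]| * N (wave T)))// ?ler_wpM2l ?hd//.
  rewrite -NZ.
  have -> : v.[1] *: wave T = p.[1] *: avg T - (u.[1] *: avg T + 'X^T * (v.[1] *: avg T)).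
    rewrite pE !hornerE/= expr1n mul1r /wave -!mul_polyC polyCD; ring.
  rewrite (le_trans (snB HN _ _))// -addrA lerD// NZ -mulrAC.
  by apply: ler_pM => //; [exact: sn_ge0|exact: sn_avg1].
rewrite mulrDl mul1r mulrAC.
have v0 : (v - (v.[1])%:P).[1] = 0 by rewrite !hornerE subrr.
have := dom_norm (dom_cat HN su su (dom_refl HN (b := u)) (dom_zero HN v0)).
rewrite !addr0 mulr0 addr0 => /le_trans; apply.
have -> : u + 'X^a * (v - (v.[1])%:P) = p - 'X^a * (v.[1])%:P by rewrite pE; ring.
rewrite (le_trans (snB HN _ _))// lerD2l (sn_Xn HN) (sn_polyC HN).
by rewrite ler_wpM2r ?normr_ge0.
Qed.

End conditional.

(** * Separable duals contain no c_0 sequence *)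

Definition countably_dense (R : realType) (X : normedModType R) : Prop :=
  exists D : nat -> X, forall x (eps : R), 0 < eps -> exists n, `|x - D n| < eps.

Lemma schauder_countably_dense (R : realType) (X : completeNormedModType R) (e : nat -> X) :
  schauder_basis e -> countably_dense X.
Proof.
move=> Ee.
pose V (q : seq rat) := \sum_(i < size q) (ratr (nth 0 q i) : R) *: e i.
pose D n := odflt 0 (omap V (unpickle n)).
have DE q : D (pickle q) = V q by rewrite /D pickleK.
exists D => x eps eps0.
have [a [ax _]] := Ee x.
have eps2 : 0 < eps / 2 by rewrite divr_gt0.
have /cvgrPdist_lt/(_ _ eps2)[n _ /(_ n (leqnn _))/= hn] := ax.
have /choice[q hq] i : exists q : rat, `|a i - ratr q| * `|e i| <= eps / 2 / n.+1%:R.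
  pose c := eps / 2 / n.+1%:R / (`|e i| + 1).
  have e1 : 0 < `|e i| + 1 by rewrite ltr_wpDl.
  have c0 : 0 < c by rewrite !divr_gt0.
  have lt : a i < a i + c by rewrite ltrDl.
  have [q] := rat_in_itvoo lt.
  rewrite in_itv/= => /andP[q1 q2]; exists q.
  have : `|a i - ratr q| <= c by rewrite ler_norml; apply/andP; split; lra.
  move=> h; apply: (@le_trans _ _ (c * (`|e i| + 1))); last by rewrite /c divfK// gt_eqF.
  by apply: ler_pM => //; rewrite lerDl.
exists (pickle (map q (iota 0 n))); rewrite DE.
rewrite -(subrK (series (fun i => a i *: e i) n) x) -addrA.
rewrite (le_lt_trans (ler_normD _ _))// [ltRHS](splitr eps) ltr_leD//.
rewrite /V size_map size_iota /series/= big_mkord -sumrB.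
rewrite (le_trans (ler_norm_sum _ _ _))//.
apply: (@le_trans _ _ (\sum_(i < n) eps / 2 / n.+1%:R)).
  apply: ler_sum => i _.
  rewrite (nth_map 0%N) ?size_iota// nth_iota// add0n -scalerBl normrZ//.
rewrite sumr_const card_ord -[_ *+ n]mulr_natr mulrAC ler_pdivrMr ?ltr0n//.
by rewrite ler_pM2l// ler_nat.
Qed.

(** Cantor's diagonal set: the codes [n] that belong to no set coded by [n]. *)
Lemma no_inj_cantor (I : (nat -> bool) -> nat) : ~ injective I.
Proof.
move=> inj.
pose G n := `[< forall H, I H = n -> ~~ H n >].
have nG : ~~ G (I G) by apply/negP => /[dup] GG /asboolP/(_ G erefl); rewrite GG.
suff : G (I G) by rewrite (negbTE nG).
by apply/asboolP => H /inj ->.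
Qed.

Section dual_space.
Context {R : realType} {X : normedModType R}.

(* Otherwise all the sums of subfamilies of w would exist in the weak* sense,
   and a sparse subfamily would make them uniformly separated. *)
Lemma dual_no_c0_sequence (w : nat -> X) (d C : R) :
  is_dual_space X -> countably_dense X -> 0 < d -> (forall i, d <= `|w i|) ->
  ~ (forall M (b : nat -> bool), `|\sum_(i < M) (b i)%:R *: w i| <= C).
Proof.
move=> [Y [T [bT isoT]]] [D hD] d0 dw hC.
pose phi i (y : Y) : R := dual_val (T (w i)) y.
have phiE M (c : nat -> R) y :
    dual_val (T (\sum_(i < M) c i *: w i)) y = \sum_(i < M) c i * phi i y.
  elim: M => [|M IH]; first by rewrite !big_ord0 linear0.
  by rewrite !big_ord_recr/= -IH linearD linearZ.
have phi_lin i a y y' : phi i (a *: y + y') = a * phi i y + phi i y'.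
  by have /set_mem[/= h _] := dual_valP (T (w i)); exact: h.
have phiC M (b : nat -> bool) y : `|y| <= 1 -> `|\sum_(i < M) (b i)%:R * phi i y| <= C.
  by move=> y1; rewrite -(phiE M (fun i => (b i)%:R)) (le_trans (dual_norm_ub _ y1))// (le_trans _ (hC M b))// -isoT.
(* The subfamilies where [phi i y] is nonnegative and negative are bounded by [C] each. *)
have abs1 M y : `|y| <= 1 -> \sum_(i < M) `|phi i y| <= C *+ 2.
  move=> y1; have h1 := phiC M (fun i => 0 <= phi i y) _ y1.
  have h2 := phiC M (fun i => phi i y < 0) _ y1.
  have -> : \sum_(i < M) `|phi i y| =
    \sum_(i < M) (0 <= phi i y)%R%:R * phi i y - \sum_(i < M) (phi i y < 0)%R%:R * phi i y.
    rewrite -sumrB; apply: eq_bigr => i _; case: (lerP 0 (phi i y)) => h.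
      by rewrite mul1r mul0r subr0 ger0_norm.
    by rewrite mul0r mul1r sub0r ltr0_norm.
  by rewrite (le_trans (ler_norm _))// (le_trans (ler_normB _ _))// mulr2n lerD.
have C0 : 0 <= C by rewrite (le_trans _ (hC 0%N xpredT)).
have phiZ i a y : phi i (a *: y) = a * phi i y.
  have phi0 : phi i 0 = 0 by have := phi_lin i (-1) 0 0; rewrite scaler0 addr0 mulN1r addNr.
  by have := phi_lin i a y 0; rewrite phi0 !addr0.
have abs M y : \sum_(i < M) `|phi i y| <= C *+ 2 * `|y|.
  have [->|y0] := eqVneq y 0.
    rewrite normr0 mulr0 big1// => i _.
    by rewrite -(scale0r 0) phiZ mul0r normr0.
  have ny : 0 < `|y| by rewrite normr_gt0.
  have := abs1 M (`|y|^-1 *: y); rewrite normfZV// lexx => /(_ isT).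
  rewrite -ler_pdivrMr// mulr_suml => /(le_trans _); apply.
  by apply: ler_sum => i _; rewrite phiZ normrM normfV normr_id mulrC.
have cv (c : nat -> bool) y : cvgn (series (fun i => (c i)%:R * phi i y : R^o)).
  apply: normed_cvg; change (cvgn (series (fun i => `|(c i)%:R * phi i y| : R^o))).
  apply: nondecreasing_is_cvgn.
    by apply: nondecreasing_series => i _ _; exact: normr_ge0.
  exists (C *+ 2 * `|y|) => _ [M _ <-]; rewrite /series/= big_mkord.
  rewrite (le_trans _ (abs M y))//; apply: ler_sum => i _.
  by rewrite normrM; case: (c i); rewrite ?normr1 ?normr0 ?mul1r ?mul0r.
(* The weak* sum of the subfamily [c]; it is a continuous functional, so surjectivity of [T]
   represents it by a vector [v c] of X. *)
pose x (c : nat -> bool) (y : Y) : R^o := limn (series (fun i => (c i)%:R * phi i y : R^o)).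
have x_lin c : linear (x c).
  move=> a y y'; apply/cvg_lim => //.
  have -> : series (fun i => (c i)%:R * phi i (a *: y + y') : R^o) =
     (fun n => a *: (series (fun i => (c i)%:R * phi i y : R^o) n)
       + series (fun i => (c i)%:R * phi i y' : R^o) n).
    apply/funext => n; rewrite /series/= scaler_sumr -big_split/=.
    by apply: eq_bigr => i _; rewrite phi_lin mulrDr mulrCA.
  by apply: cvgD; [apply: cvgZl_tmp; exact: cv|exact: cv].
have x_bd c y : `|x c y| <= C *+ 2 * `|y|.
  rewrite /x -lim_norm; last exact: cv.
  apply: limr_le; first by apply: is_cvg_norm; exact: cv.
  near=> M; rewrite /series/= big_mkord (le_trans _ (abs M y))//.
  rewrite (le_trans (ler_norm_sum _ _ _))//; apply: ler_sum => i _.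
  by rewrite normrM; case: (c i); rewrite ?normr1 ?normr0 ?mul1r ?mul0r.
have x_cont c : continuous (x c).
  pose g : {linear Y -> R^o} := HB.pack (x c) (GRing.isLinear.Build _ _ _ _ (x c) (x_lin c)).
  apply: (@bounded_linear_continuous _ _ _ g); apply/linear_boundedP.
  near=> r => y; rewrite (le_trans (x_bd c y))// ler_wpM2r//.
have xP c : x c \in @cont_linear R Y by rewrite inE.
have [T' TK T'K] := bT.
pose v c := T' (Dual (xP c)).
have vE c y : dual_val (T (v c)) y = x c y by rewrite /v T'K.
have /choice[y hy] i : exists y : Y, `|y| <= 1 /\ d / 2 < `|phi i y|.
  apply: contrapT => ny.
  have : `|T (w i)| <= d / 2.
    apply: dual_norm_le => y y1; rewrite leNgt; apply/negP => lt; apply: ny.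
    by exists y.
  by rewrite isoT leNgt (lt_le_trans _ (dw i))// ltr_pdivrMr// ltr_pMr// ltr1n.
have /choice[n hn] i : exists n, (i < n)%N /\
    forall M, \sum_(n <= j < M) `|phi j (y i)| <= d / 4.
  have : cvgn (series (fun j => `|phi j (y i)| : R^o)).
    apply: nondecreasing_is_cvgn.
      by apply: nondecreasing_series => j _ _; exact: normr_ge0.
    by exists (C *+ 2 * `|y i|) => _ [M _ <-]; rewrite /series/= big_mkord.
  move=> /cauchy_cvgP/cauchy_seriesP/(_ (d / 4)); rewrite divr_gt0// => /(_ isT).
  move=> [[P Q] [/= [n0 _ hP] [n1 _ hQ]] h].
  exists (maxn n0 i.+1); split; first by rewrite leq_maxr.
  move=> M; have [Mn|nM] := leqP M (maxn n0 i.+1); first by rewrite big_geq ?divr_ge0 ?ltW.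
  pose M' := maxn n1 M.
  apply: (@le_trans _ _ (\sum_(maxn n0 i.+1 <= j < M') `|phi j (y i)|)).
    rewrite [leRHS](@big_cat_nat _ _ _ M)/= ?leq_maxr ?(ltnW nM)//.
    by rewrite lerDl sumr_ge0.
  rewrite -[leLHS]ger0_norm ?sumr_ge0// ltW//.
  apply: (h (_, M')); split => /=; [apply: hP|apply: hQ]; exact: leq_maxl.
(* Each index of the sparse set is the point from which the series of [|phi j|] at the previous [y]
   has tail at most [d / 4]. *)
pose g k := iter k n 0%N.
have gS k : (g k < g k.+1)%N by rewrite /g iterS; case: (hn (g k)).
have g_homo : {homo g : i j / (i < j)%N} by apply: homo_ltn => //; exact: ltn_trans.
have g_mono i j : (g i < g j)%N -> (i < j)%N.
  move=> lt; rewrite ltnNge; apply/negP; rewrite leq_eqVlt => /predU1P[E|/g_homo].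
    by move: lt; rewrite E ltnn.
  by move=> /(ltn_trans lt); rewrite ltnn.
pose c (G : nat -> bool) j := `[< exists2 k, j = g k & G k >].
have cg G k : c G (g k) = G k.
  apply/asboolP/idP => [[k' E Gk']|]; last by exists k.
  suff -> : k = k' by [].
  by case: (ltngtP k k') => // /g_homo; rewrite E ltnn.
(* At the first difference [k], test on [y (g k)]: the earlier terms cancel, the term at [g k]
   exceeds [d / 2], nothing lies between [g k] and [g k.+1], and the rest is at most [d / 4]. *)
have sep G G' : G <> G' -> d / 4 <= `|v (c G) - v (c G')|.
  move=> neq; have ex : exists k, G k != G' k.
    apply: contrapT => nk; apply: neq; apply/funext => k; apply/eqP.
    by apply: contrapT => /negP h; apply: nk; exists k.
  case: (ex_minnP ex) => k Gk mink.
  pose u j := ((c G j)%:R - (c G' j)%:R) * phi j (y (g k)).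
  have u1 j : `|u j| <= `|phi j (y (g k))|.
    rewrite normrM ler_piMl//.
    by case: (c G j); case: (c G' j); rewrite ?subrr ?subr0 ?sub0r ?normrN ?normr0 ?normr1.
  have agree i : (i < k)%N -> G i = G' i.
    by move=> ik; apply/eqP; apply: contraTT ik => /mink; rewrite -leqNgt.
  have u_small j : (j < g k)%N -> u j = 0.
    move=> jk; rewrite /u; suff -> : c G j = c G' j by rewrite subrr mul0r.
    by apply: asbool_equiv_eq; split => -[i E Gi]; exists i => //; move: Gi;
      rewrite agree//; apply: g_mono; rewrite -E.
  have u_gap j : (g k < j)%N -> (j < n (g k))%N -> u j = 0.
    move=> kj jn; have cF H : c H j = false.
      apply/asboolP => -[i E _]; move: kj jn; rewrite E => /g_mono ki jn.
      have /g_mono : (g i < g k.+1)%N by [].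
      by rewrite ltnS leqNgt ki.
    by rewrite /u !cF subrr mul0r.
  have u_k : `|u (g k)| = `|phi (g k) (y (g k))|.
    rewrite /u !cg normrM; move: Gk; case: (G k); case: (G' k) => //= _;
      by rewrite ?subr0 ?sub0r ?normrN normr1 mul1r.
  have big M : (n (g k) <= M)%N -> d / 4 <= `|\sum_(0 <= j < M) u j|.
    move=> nM; have kn : (g k < n (g k))%N by case: (hn (g k)).
    rewrite (@big_cat_nat _ _ _ (n (g k)))//= (@big_cat_nat _ _ _ (g k))//= ?(ltnW kn)//.
    rewrite big_nat big1 ?add0r => [|j /andP[_ /u_small//]].
    rewrite big_ltn// big_nat big1 ?addr0 => [|j /andP[h1 h2]]; last exact: u_gap.
    rewrite -[X in _ + X]opprK (le_trans _ (lerB_dist _ _))// normrN u_k.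
    have h1 : `|\sum_(n (g k) <= j < M) u j| <= d / 4.
      rewrite (le_trans (ler_norm_sum _ _ _))//.
      rewrite (le_trans _ ((hn (g k)).2 M))//; apply: ler_sum => j _; exact: u1.
    have h2 := (hy (g k)).2; lra.
  have Tv : dual_val (T (v (c G) - v (c G'))) (y (g k)) =
      x (c G) (y (g k)) - x (c G') (y (g k)).
    by rewrite linearB -!vE.
  have : d / 4 <= `|x (c G) (y (g k)) - x (c G') (y (g k))|.
    have cu : (fun M => `|\sum_(0 <= j < M) u j|) @ \oo -->
        `|x (c G) (y (g k)) - x (c G') (y (g k))|.
      have -> : (fun M => `|\sum_(0 <= j < M) u j|) = (fun M =>
        `|series (fun i => (c G i)%:R * phi i (y (g k)) : R^o) M -
          series (fun i => (c G' i)%:R * phi i (y (g k)) : R^o) M|).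
        apply/funext => M; rewrite /series/= -sumrB; congr `|_|.
        by apply: eq_bigr => i _; rewrite /u mulrBl.
      by apply: cvg_norm; apply: cvgB; exact: cv.
    rewrite -(cvg_lim _ cu)//; apply: limr_ge; first by apply/cvg_ex; eexists; exact: cu.
    by exists (n (g k)) => // M /=; exact: big.
  move=> /le_trans; apply; rewrite -Tv -isoT.
  by apply: dual_norm_ub; case: (hy (g k)).
have d8 : 0 < d / 8 by rewrite divr_gt0.
have /choice[I hI] G : exists n, `|v (c G) - D n| < d / 8 by exact: hD.
apply: (@no_inj_cantor I) => G G' E; apply: contrapT => /sep.
apply/negP; rewrite -ltNge.
have -> : v (c G) - v (c G') = (v (c G) - D (I G)) - (v (c G') - D (I G')).
  by rewrite E opprB addrA subrK.
rewrite (le_lt_trans (ler_normB _ _))//.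
have -> : d / 4 = d / 8 + d / 8 by lra.
by rewrite ltrD.
Unshelve. all: by end_near. Qed.

End dual_space.

(** * Bounded completeness and limits along an ultrafilter *)

Lemma sum_half_le (R : realType) M : \sum_(k < M) (2^-1 : R) ^+ k <= 2.
Proof.
suff -> : \sum_(k < M) (2^-1 : R) ^+ k = 2 - 2 * 2^-1 ^+ M.
  by rewrite gerBl mulr_ge0// exprn_ge0// invr_ge0.
elim: M => [|M IH]; first by rewrite big_ord0 expr0 mulr1 subrr.
by rewrite big_ord_recr/= IH exprS mulrA divff// mul1r; ring.
Qed.

Lemma half_pow_le1 (R : realType) k : (2^-1 : R) ^+ k <= 1.
Proof. by apply: exprn_ile1 => //; rewrite invf_le1// ler1n. Qed.

Lemma half_pow_ge0 (R : realType) k : 0 <= (2^-1 : R) ^+ k.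
Proof. by rewrite exprn_ge0// invr_ge0. Qed.

Lemma ultra_bounded_lim (R : realType) (U : set_system nat) (u : nat -> R) C :
  UltraFilter U -> (forall i, `|u i| <= C) ->
  exists l, forall d, 0 < d -> U [set i | `|u i - l| <= d].
Proof.
move=> UU uC.
have PU : ProperFilter (u @ U) by apply: fmap_proper_filter; case: UU.
have inC : (u @ U) `[- C, C]%classic.
  suff : U [set i | `[- C, C]%classic (u i)] by [].
  apply: filterS (@filterT _ U _) => i _ /=; rewrite in_itv/= -ler_norml; exact: uC.
have [l [_ cl]] := @segment_compact R (- C) C _ PU inC.
exists l => d d0.
have [//|nU] := in_ultra_setVsetC [set i | `|u i - l| <= d] UU.
have [x [/= ux lx]] := cl [set x | ~ `|x - l| <= d] (ball l d) nU (nbhsx_ballx l d d0).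
by exfalso; apply: ux; rewrite distrC ltW.
Qed.

Section weak_star.
Context {R : realType} {X : completeNormedModType R}.
Variable e : nat -> X.
Hypothesis Xd : is_dual_space X.
Hypothesis Ce : conditional_spreading_basis e.
Implicit Types (p q u v : {poly R}).
Local Notation N := (vnorm e).

Let Ee : schauder_basis e. Proof. by case: Ce. Qed.
Let HN := cond_spreading Ce.
Let ND p q : N (p + q) <= N p + N q. Proof. by case: HN. Qed.
Let NZ c p : N (c *: p) = `|c| * N p. Proof. by case: HN. Qed.

Lemma vec_conf (a : nat -> nat) m (b : nat -> {poly R}) :
  vec e (conf a m b) = \sum_(t < m) vec e ('X^(a t) * b t).
Proof.
elim: m => [|m IH]; first by rewrite conf0 big_ord0 /vec size_poly0 big_ord0.
by rewrite confS vecD IH big_ord_recr.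
Qed.

(** If the sums were bounded, deleting zero-sum blocks would bound all sums of subfamilies, giving a
    c_0 sequence in X. *)
Lemma zero_sum_blocks_unbounded (a : nat -> nat) (z : nat -> {poly R}) d C :
  0 < d -> (forall t, (z t).[1] = 0) -> (forall m, fits a m z) ->
  (forall t, d <= N (z t)) -> exists M, C < N (conf a M z).
Proof.
move=> d0 z0 fz dz; apply: contrapT => nM.
have hM M : N (conf a M z) <= C.
  by rewrite leNgt; apply/negP => lt; apply: nM; exists M.
apply: (@dual_no_c0_sequence _ _ (fun i => vec e ('X^(a i) * z i)) d C Xd _ d0).
- exact: schauder_countably_dense Ee.
- by move=> i; rewrite (le_trans (dz i))// -(sn_Xn HN (a i)).
move=> M b.
have -> : \sum_(i < M) (b i)%:R *: vec e ('X^(a i) * z i) =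
    vec e (conf a M (fun i => (b i)%:R *: z i)).
  by rewrite vec_conf; apply: eq_bigr => i _; rewrite -vecZ scalerAr.
rewrite (le_trans _ (hM M))//.
have h : forall t, (t < M)%N -> dom N (z t) ((b t)%:R *: z t) 0.
  by move=> t _; apply: dom_shrink => //; case: (b t); rewrite !lexx ler01.
have := sn_conf_le HN (fz M) _ h; rewrite big1// addr0; apply.
move=> t tM; rewrite (leq_trans _ (fz M t tM))// leq_add2l.
exact: size_scale_leq.
Qed.

Variable U : set_system nat.
Hypothesis UU : UltraFilter U.
Hypothesis Uoo : \oo `<=` U.

Let PU : ProperFilter U. Proof. by case: UU. Qed.

(** If the partial sums were not Cauchy, they could be cut into blocks of norm bounded below, at
    places where the coefficient sum is geometrically close to one limit [l]. The blocks are then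
    nearly zero-sum, and after correction they contradict [zero_sum_blocks_unbounded]. *)
Lemma boundedly_complete (a : nat -> R) C :
  (forall n, N (\poly_(i < n) a i) <= C) ->
  forall eps, 0 < eps -> exists n0, forall n, (n0 <= n)%N ->
    N (\poly_(i < n) a i - \poly_(i < n0) a i) <= eps.
Proof.
move=> sC eps eps0; pose s n := \poly_(i < n) a i.
apply: contrapT => nn0.
have bad n0 : exists2 n, (n0 <= n)%N & eps < N (s n - s n0).
  apply: contrapT => nn; apply: nn0; exists n0 => n n0n.
  by rewrite leNgt; apply/negP => lt; apply: nn; exists n.
have take_s n m : (n <= m)%N -> take_poly n (s m) = s n.
  move=> nm; apply/polyP => i; rewrite coef_take_poly !coef_poly.
  by case: ltnP => // /leq_trans -> //.
have [B B0 hB] := cond_sum_bounded Ce; have [K K0 hK] := cond_basis_constant Ce.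
have Sb i : `|(s i).[1]| <= B * C.
  by rewrite (le_trans (hB _))// ler_wpM2l ?(ltW B0)// sC.
have [l hl] := ultra_bounded_lim UU Sb.
pose eps' := eps / K; have eps'0 : 0 < eps' by rewrite divr_gt0.
have N1 : 0 <= N 1 by exact: sn_ge0.
pose eta := eps' / (4 * (N 1 + 1)).
have eta0 : 0 < eta by rewrite divr_gt0// mulr_gt0// ltr_wpDl.
have etaN : eta * 2 * N 1 <= eps' / 2.
  have -> : eps' / 2 = eta * 2 * (N 1 + 1).
    by rewrite /eta; field; rewrite gt_eqF// ltr_wpDl.
  by rewrite ler_wpM2l ?lerDl// mulr_ge0// ltW.
(* The new cut lies past a place [m] where the increment already exceeds [eps]; the basis constant
   [K] preserves [eps / K] of it. *)
have next (nk : nat * nat) : exists n', [/\ (nk.1 < n')%N,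
    `|(s n').[1] - l| <= eta * 2^-1 ^+ nk.2 & eps' <= N (s n' - s nk.1)].
  case: nk => n k /=; have [m nm hm] := bad n.
  have Um : U [set i | (maxn n.+1 m <= i)%N] by apply: Uoo; exists (maxn n.+1 m).
  have dk : 0 < eta * 2^-1 ^+ k by rewrite mulr_gt0// exprn_gt0// invr_gt0.
  have [n' [/= h2 h1]] := filter_ex (filterI Um (hl _ dk)).
  rewrite geq_max in h2; case/andP: h2 => h2 h3.
  exists n'; split => //; rewrite /eps' ler_pdivrMr// mulrC.
  rewrite (le_trans _ (hK (s n' - s n) m))// linearB/= take_s// (ltW (lt_le_trans hm _))//.
  have -> : take_poly m (s n) = s n.
    by apply: take_poly_id; rewrite (leq_trans (size_poly _ _)).
  by [].
have {next}[nx hnx] := choice next.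
pose h := fix h k := if k is k'.+1 then nx (h k', k'.+1) else nx (0%N, 0%N).
have hS k : (h k < h k.+1)%N by case: (hnx (h k, k.+1)).
have hl1 k : `|(s (h k)).[1] - l| <= eta * 2^-1 ^+ k.
  by case: k => [|k]; [case: (hnx (0%N, 0%N))|case: (hnx (h k, k.+1))].
have hN k : eps' <= N (s (h k.+1) - s (h k)) by case: (hnx (h k, k.+1)).
pose b k := drop_poly (h k) (s (h k.+1)).
have bE k : s (h k.+1) - s (h k) = 'X^(h k) * b k.
  by rewrite {1}(take_polyK (h k) (s (h k.+1))) take_s ?(ltnW (hS k))// addrC addKr.
have b1 k : `|(b k).[1]| <= eta * 2 * 2^-1 ^+ k.
  have -> : (b k).[1] = (s (h k.+1)).[1] - l - ((s (h k)).[1] - l).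
    have := congr1 (fun p => p.[1]) (bE k); rewrite !hornerE/= expr1n mul1r => <-.
    by rewrite opprB addrA subrK.
  rewrite (le_trans (ler_normB _ _))// [eta * 2]mulr_natr mulr2n mulrDl lerD//.
  rewrite (le_trans (hl1 _))// ler_wpM2l ?(ltW eta0)// exprS.
  by rewrite ler_piMl ?half_pow_ge0// invf_le1// ler1n.
pose z k := b k - ((b k).[1])%:P.
have sb k : (h k + size (b k) <= h k.+1)%N.
  by rewrite size_drop_poly -leq_subRL ?(ltnW (hS k))// leq_sub2r// size_poly.
have sz k : (h k + size (z k) <= h k.+1)%N.
  rewrite -leq_subRL ?(ltnW (hS k))//.
  rewrite (leq_trans (size_polyD _ _))// geq_max size_polyN leq_subRL ?sb ?(ltnW (hS k))//.
  by rewrite (leq_trans (size_polyC_leq1 _))// subn_gt0.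
have Nz k : eps' / 2 <= N (z k).
  have := sn_le_sub HN (b k) (z k).
  have -> : b k - z k = ((b k).[1])%:P by rewrite /z opprB addrC subrK.
  rewrite (sn_polyC HN) => h1.
  have h2 := hN k; rewrite bE (sn_Xn HN) in h2.
  have h3 : `|(b k).[1]| * N 1 <= eps' / 2.
    rewrite (le_trans _ etaN)// ler_wpM2r// (le_trans (b1 k))//.
    by rewrite ler_piMr ?half_pow_le1// mulr_ge0// ltW.
  move: (le_trans h2 h1) h3; lra.
have z0 k : (z k).[1] = 0 by rewrite !hornerE subrr.
have eps'2 : 0 < eps' / 2 by rewrite divr_gt0.
(* The uncorrected blocks telescope to a difference of two partial sums, and the corrections form a
   geometric series. *)
have [M] := @zero_sum_blocks_unbounded h z _ (C + C + eta * 4 * N 1) eps'2 z0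
   (fun m t _ => sz t) Nz.
apply/negP; rewrite -leNgt.
rewrite (@confD _ _ _ b (fun k => - ((b k).[1])%:P)).
have -> : conf h M b = s (h M) - s (h 0).
  elim: M => [|M IH]; first by rewrite conf0 subrr.
  by rewrite confS IH -bE addrC addrA subrK.
rewrite (le_trans (ND _ _))// lerD//.
  by rewrite (le_trans (snB HN _ _))//; apply: lerD; exact: sC.
rewrite (le_trans (sn_sum HN _ _ _))//.
apply: (@le_trans _ _ (\sum_(k < M) eta * 2 * N 1 * 2^-1 ^+ k)).
  apply: ler_sum => k _; rewrite (sn_Xn HN) (snN HN) (sn_polyC HN) mulrAC.
  by rewrite ler_wpM2r.
rewrite -mulr_sumr; have -> : eta * 4 * N 1 = eta * 2 * N 1 * 2 by ring.
apply: ler_wpM2l; last exact: sum_half_le.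
by apply: mulr_ge0 => //; rewrite mulr_ge0 ?ltW.
Qed.

Lemma coef_bounded : exists2 B, 0 < B & forall p i, `|p`_i| <= B * N p.
Proof.
have [K K0 hK] := cond_basis_constant Ce.
have N1 : 0 < N 1 by apply: vnorm_gt0 => //; exact: oner_neq0.
exists ((K + K) / N 1) => [|p i]; first by rewrite divr_gt0// addr_gt0.
rewrite mulrAC ler_pdivlMr// -(sn_polyC HN) -(sn_Xn HN i).
have -> : 'X^i * (p`_i)%:P = take_poly i.+1 p - take_poly i p.
  apply/polyP => j; rewrite coefB coefXnM coefC !coef_take_poly ltnS.
  case: (ltngtP j i) => [ji|ji|->]; rewrite ?subrr ?subn_eq0//.
  - by rewrite leqNgt ji.
  - by rewrite leqnn subr0.
by rewrite (le_trans (snB HN _ _))// mulrDl lerD.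
Qed.

Lemma take_polyS n p : take_poly n.+1 p = take_poly n p + (p`_n) *: 'X^n.
Proof. by rewrite /take_poly !poly_def big_ord_recr. Qed.

(** The coordinatewise limits have bounded partial sums, so by bounded completeness one partial sum
    [g] is close to all later ones. Being a polynomial, [g] is only an approximate limit; [C']
    depends on neither [h] nor [eps], so that limits can be iterated. *)
Lemma bounded_ultra_lim C : exists C', forall (h : nat -> {poly R}) (eps : R),
  0 < eps -> (forall i, N (h i) <= C) ->
  exists2 g, N g <= C' & forall a, U [set i | N (take_poly a (h i - g)) <= eps].
Proof.
have [B B0 hB] := coef_bounded; have [K K0 hK] := cond_basis_constant Ce.
exists (K * C + 1) => h eps eps0 hC.
have N1 : 0 <= N 1 by exact: sn_ge0.
have /choice[a ha] j : exists l, forall d, 0 < d -> U [set i | `|(h i)`_j - l| <= d].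
  apply: (@ultra_bounded_lim _ _ _ (B * C)) => // i.
  by rewrite (le_trans (hB _ _))// ler_wpM2l// ltW.
pose s n := \poly_(i < n) a i.
have sS n : s n.+1 = s n + a n *: 'X^n.
  by rewrite /s !poly_def big_ord_recr.
have near_s n d : 0 < d -> U [set i | N (take_poly n (h i) - s n) <= d].
  elim: n d => [|n IH] d d0.
    apply: filterS (@filterT _ U _) => i _ /=.
    by rewrite take_poly0l /s poly_def big_ord0 subrr (sn0 HN) ltW.
  have d2 : 0 < d / 2 by rewrite divr_gt0.
  have d3 : 0 < d / 2 / (N 1 + 1) by rewrite divr_gt0// ltr_wpDl.
  apply: filterS (filterI (IH _ d2) (ha n _ d3)) => i [/= h1 h2].
  rewrite take_polyS sS opprD addrACA -scalerBl (le_trans (ND _ _))//.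
  rewrite [leRHS](splitr d) lerD// NZ -['X^n]mulr1 (sn_Xn HN).
  rewrite (@le_trans _ _ (d / 2 / (N 1 + 1) * (N 1 + 1)))//.
    by apply: ler_pM => //; rewrite lerDl.
  by rewrite divfK// gt_eqF// ltr_wpDl.
have sC n : N (s n) <= K * C + 1.
  have [i /= hi] := filter_ex (near_s n 1 ltr01).
  rewrite (le_trans (sn_le_sub HN _ (take_poly n (h i))))// (snC HN (s n)) lerD//.
  by rewrite (le_trans (hK _ _))// ler_wpM2l// ltW.
have eps2 : 0 < eps / 2 by rewrite divr_gt0.
have [n0 hn0] := boundedly_complete sC eps2.
exists (s n0) => // n.
apply: filterS (near_s n _ eps2) => i /= hi.
rewrite linearB/=; have [n0n|nn0] := leqP n0 n.
  rewrite (@take_poly_id _ n (s n0)); last by rewrite (leq_trans (size_poly _ _)).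
  rewrite (le_trans (sn_sub_le HN _ (s n) _))// [leRHS](splitr eps) lerD//.
  exact: hn0.
have -> : take_poly n (s n0) = s n.
  apply/polyP => j; rewrite coef_take_poly !coef_poly.
  by case: ltnP => // jn; rewrite (ltn_trans jn nn0).
by rewrite (le_trans hi)// ler_pdivrMr// ler_pMr// ler1n.
Qed.

End weak_star.

(** * Iterated limits over tuples and sparse selection *)

(** Iterated limits, last coordinate first: the value at a tuple is a limit, in the sense of [Q], of
    the values at its one-step extensions. Both [T] and [Q] are abstract since vectors and
    coefficient sums are treated alike. *)
Lemma tree_extension (T : Type) (bdd : (seq nat -> T) -> Prop)
    (Q : (nat -> T) -> T -> Prop) :
  (forall f, bdd f -> exists2 g, bdd g & forall n, Q (fun i => f (rcons n i)) (g n)) ->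
  (forall f g k, bdd f -> bdd g -> bdd (fun n => if (size n <= k)%N then f n else g n)) ->
  forall k f, bdd f -> exists G, [/\ bdd G, forall n, size n = k -> G n = f n
    & forall n, (size n < k)%N -> Q (fun i => G (rcons n i)) (G n)].
Proof.
move=> step glue; elim=> [|k IH] f bf; first by exists f.
have [g bg gQ] := step f bf; have [G [bG Gg GQ]] := IH g bg.
exists (fun n => if (size n <= k)%N then G n else f n); split.
- exact: glue.
- by move=> n ->; rewrite ltnn.
move=> n; rewrite ltnS => nk; rewrite nk.
under [X in Q X]funext => i do rewrite size_rcons.
by case: ltngtP nk => // [nk|nk] _; [exact: GQ|rewrite Gg].
Qed.

(** At each time only finitely many tuples of earlier picks exist, so one new pick in U suits all of
    them at once. This is why the same [nu] and [a] serve every [tau]. *)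
Lemma sparse_selection (U : set_system nat) (PU : ProperFilter U) (Uoo : \oo `<=` U)
    (k : nat) (P : nat -> seq nat -> nat -> Prop) (w : seq nat -> nat -> nat) :
  (forall a n, (size n < k)%N -> U [set i | P a n i]) ->
  exists nu a : nat -> nat, {homo nu : i j / (i < j)%N} /\
    forall tau, {homo tau : i j / (i < j)%N} -> forall j, (j < k)%N ->
      P (a (tau j)) (mkseq (nu \o tau) j) (nu (tau j)) /\
      (w (mkseq (nu \o tau) j) (nu (tau j)) <= a (tau j).+1)%N /\
      (a (tau j) <= a (tau j).+1)%N.
Proof.
move=> UP.
have ex (st : seq (seq nat) * nat * nat) : exists i, (st.2 < i)%N /\
    forall n, n \in st.1.1 -> (size n < k)%N -> P st.1.2 n i.
  case: st => [[L a] q] /=.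
  have UL : U [set i | forall n, n \in L -> (size n < k)%N -> P a n i].
    elim: L => [|n L IH]; first by apply: filterS (@filterT _ U _) => i _ n.
    have Un : U [set i | (size n < k)%N -> P a n i].
      have [nk|nk] := ltnP (size n) k; last first.
        by apply: filterS (@filterT _ U _) => i _ /=.
      by apply: filterS (UP a n nk) => i Pi /=.
    apply: filterS (filterI Un IH) => i [/= h1 h2] n'.
    by rewrite inE => /predU1P[->|]; [exact: h1|exact: h2].
  have Uq : U [set i | (q < i)%N] by apply: Uoo; exists q.+1.
  by have [i [/= h1 h2]] := filter_ex (filterI Uq UL); exists i.
have {ex}[pick hpick] := choice ex.
(* A state holds all tuples of picks so far, the start of the current slot and the last pick. Adding
   all the widths [w n i] makes the slot wide enough for each tuple. *)
pose next (st : seq (seq nat) * nat * nat) : seq (seq nat) * nat * nat :=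
  let i := pick st in
  (st.1.1 ++ [seq rcons n i | n <- st.1.1], st.1.2 + \sum_(n <- st.1.1) w n i, i)%N.
pose st t := iter t next ([:: [::]], 0%N, 0%N).
pose nu t := pick (st t).
have stS t : st t.+1 = next (st t) by [].
exists nu, (fun t => (st t).1.2).
have nuS t : (nu t < nu t.+1)%N by have [] := hpick (st t.+1).
have L_mono t t' n : (t <= t')%N -> n \in (st t).1.1 -> n \in (st t').1.1.
  move=> /subnKC <-; elim: (t' - t)%N => [|m IH nL]; first by rewrite addn0.
  by rewrite addnS stS /= mem_cat IH.
split; first by apply: homo_ltn nuS => //; exact: ltn_trans.
move=> tau htau.
have mem_tau j : mkseq (nu \o tau) j \in (st (tau j)).1.1.
  elim: j => [|j IH]; first by apply: (@L_mono 0%N) => //; rewrite /st/= inE.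
  apply: (@L_mono (tau j).+1); first exact: htau.
  by rewrite stS /= mem_cat mkseqS (mem_map (@rcons_injl _ _)) IH orbT.
move=> j jk; split; last split.
- by have [_] := hpick (st (tau j)); apply => //; rewrite size_mkseq.
- rewrite stS /= (leq_trans _ (leq_addl _ _))//.
  rewrite (big_rem _ (mem_tau j))/= leq_addr//.
- by rewrite stS /= leq_addr.
Qed.

(** * Asymptotic block form of a bounded function of tuples *)

Section asymptotics.
Context {R : realType} {X : completeNormedModType R}.
Variable e : nat -> X.
Hypothesis Xd : is_dual_space X.
Hypothesis Ce : conditional_spreading_basis e.
Implicit Types (p q u v : {poly R}).
Local Notation N := (vnorm e).

Let HN := cond_spreading Ce.

(* Along any increasing choice of times the value of f is, up to a constant and a
   small error, a sum of successive blocks whose j-th coefficient sum is nearly c j,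
   whatever the choice is. *)
Lemma asymptotic_blocks (k : nat) (f : seq nat -> {poly R}) C (eps : R) :
  (forall n, N (f n) <= C) -> 0 < eps ->
  exists (c : nat -> R) (nu a : nat -> nat) (b : seq nat -> {poly R}) (g : {poly R}),
    {homo nu : i j / (i < j)%N} /\
    forall tau, {homo tau : i j / (i < j)%N} ->
      N (f (mkseq (nu \o tau) k) - g
         - \sum_(j < k) 'X^(a (tau j)) * b (mkseq tau j.+1)) <= eps /\
      forall j, (j < k)%N ->
        (a (tau j) + size (b (mkseq tau j.+1)) <= a (tau j).+1)%N /\
        `|(b (mkseq tau j.+1)).[1] - c j| <= eps.
Proof.
move=> fC eps0.
have [B B0 hB] := cond_sum_bounded Ce.
have [U [UU Uoo]] := ultraFilterLemma (_ : ProperFilter (\oo : set_system nat)).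
have PU : ProperFilter U by case: UU.
(* The norm estimate spends [k d]; a coefficient sum spends [k d] for each of its two ends and [B d]
   for the truncation. *)
pose d := eps / (k.*2.+1%:R + B + 1).
have D0 : 0 < k.*2.+1%:R + B + 1 by rewrite !addr_gt0.
have d0 : 0 < d by rewrite divr_gt0.
have dE : eps = d * (k.*2.+1%:R + B + 1) by rewrite /d divfK// gt_eqF.
pose bddp (G : seq nat -> {poly R}) := exists C, forall n, N (G n) <= C.
pose bddr (G : seq nat -> R) := exists C, forall n, `|G n| <= C.
have [G [[C' GC'] Gf GQ]] : exists G, [/\ bddp G, forall n, size n = k -> G n = f n
    & forall n, (size n < k)%N -> forall a,
      U [set i | N (take_poly a (G (rcons n i) - G n)) <= d]].
  apply: (@tree_extension _ bddp (fun h g => forall a,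
    U [set i | N (take_poly a (h i - g)) <= d])); last by exists C.
  - move=> h [Ch hC].
    have [C' hC'] := bounded_ultra_lim Xd Ce UU Uoo Ch.
    have /choice[g hg] n : exists g, N g <= C' /\
        forall a, U [set i | N (take_poly a (h (rcons n i) - g)) <= d].
      have [g g1 g2] := hC' (fun i => h (rcons n i)) d d0 (fun i => hC _).
      by exists g.
    exists g; first by exists C' => n; case: (hg n).
    by move=> n; case: (hg n).
  - move=> h1 h2 m [C1 H1] [C2 H2]; exists (Num.max C1 C2) => n.
    by case: ifP => _; rewrite le_max ?H1// H2 orbT.
have bS : bddr (fun n => (G n).[1]).
  by exists (B * C') => n; rewrite (le_trans (hB _))// ler_wpM2l// ltW.
(* Coordinatewise limits need not preserve coefficient sums, so the sums on each level [j] get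
   iterated limits of their own, down to [sg j [::]] at the empty tuple. *)
have /choice[sg hsg] j : exists s : seq nat -> R,
    (forall n, size n = j -> s n = (G n).[1]) /\
    forall n, (size n < j)%N -> U [set i | `|s (rcons n i) - s n| <= d].
  have [s [_ s1 s2]] : exists s, [/\ bddr s, forall n, size n = j -> s n = (G n).[1]
      & forall n, (size n < j)%N -> forall d, 0 < d -> U [set i | `|s (rcons n i) - s n| <= d]].
    apply: (@tree_extension _ bddr (fun h l =>
      forall d, 0 < d -> U [set i | `|h i - l| <= d])); last exact: bS.
    - move=> u [Cu uC].
      have /choice[l hl] n : exists l, forall d, 0 < d -> U [set i | `|u (rcons n i) - l| <= d].
        by apply: (@ultra_bounded_lim _ _ _ Cu).
      exists l => //; exists (Cu + 1) => n.
      have [i /= hi] := filter_ex (hl n 1 ltr01).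
      have -> : l n = u (rcons n i) - (u (rcons n i) - l n) by rewrite opprB addrC subrK.
      by rewrite (le_trans (ler_normB _ _))// lerD.
    - move=> h1 h2 m [C1 H1] [C2 H2]; exists (Num.max C1 C2) => n.
      by case: ifP => _; rewrite le_max ?H1// H2 orbT.
  by exists s; split => // n nj; exact: s2.
pose P a n i := N (take_poly a (G (rcons n i) - G n)) <= d /\
  forall j : 'I_k.+1, (size n < j)%N -> `|sg j (rcons n i) - sg j n| <= d.
have UP a n : (size n < k)%N -> U [set i | P a n i].
  move=> nk.
  have U2 : U [set i | forall j : 'I_k.+1, (size n < j)%N -> `|sg j (rcons n i) - sg j n| <= d].
    apply: filter_forall => j.
    have [nj|nj] := ltnP (size n) j; last first.
      by apply: filterS (@filterT _ U _) => i _ /=.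
    by case: (hsg j) => _ /(_ n nj); apply: filterS => i.
  by apply: filterS (filterI (GQ n nk a) U2) => i [].
have [nu [a [nu_homo sel]]] := sparse_selection PU Uoo (fun n i => size (G (rcons n i) - G n)) UP.
(* The increment caused by the last time of [s]. Its part before the slot has norm at most [d], and
   [b s] is the part from the slot start on. *)
pose D s := G (map nu s) - G (map nu (take (size s).-1 s)).
pose b s := drop_poly (a (last 0%N s)) (D s).
exists (fun j => sg j.+1 [::] - sg j [::]), nu, a, b, (G [::]); split => //.
move=> tau htau.
pose n j := mkseq (nu \o tau) j.
have nS j : n j.+1 = rcons (n j) (nu (tau j)) by rewrite /n mkseqS.
have mapn j : map nu (mkseq tau j) = n j by rewrite /n /mkseq -map_comp.
have Dn j : D (mkseq tau j.+1) = G (n j.+1) - G (n j).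
  rewrite /D mapn size_mkseq/=; congr (_ - G _).
  by rewrite mkseqS -cats1 take_size_cat ?size_mkseq.
have lastn j : last 0%N (mkseq tau j.+1) = tau j by rewrite mkseqS last_rcons.
have bE j : 'X^(a (tau j)) * b (mkseq tau j.+1) =
    G (n j.+1) - G (n j) - take_poly (a (tau j)) (G (n j.+1) - G (n j)).
  rewrite /b lastn Dn; set q := G _ - G _.
  by rewrite {2}(take_polyK (a (tau j)) q) addrC addKr.
have selP j : (j < k)%N -> P (a (tau j)) (n j) (nu (tau j)) by move=> /(sel tau htau)[].
split.
  rewrite -(Gf (n k)) ?size_mkseq//.
  have -> : G (n k) - G [::] = \sum_(j < k) (G (n j.+1) - G (n j)).
    by rewrite -(big_mkord xpredT (fun j => G (n j.+1) - G (n j))) telescope_sumr.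
  rewrite -sumrB (le_trans (sn_sum HN _ _ _))//.
  apply: (@le_trans _ _ (\sum_(j < k) d)).
    apply: ler_sum => j _; rewrite bE opprB addrC subrK.
    by have [+ _] := selP j (ltn_ord j); rewrite nS.
  rewrite sumr_const card_ord -mulr_natr dE ler_pM2l// -addrA.
  rewrite ler_wpDr ?addr_ge0 ?ltW// ltr_nat ltnS -addnn leq_addr//.
move=> j jk; split.
  have [_ [h1 h2]] := sel tau htau j jk.
  rewrite /b lastn size_drop_poly Dn -leq_subRL// leq_sub2r// nS//.
have sg_near i m : (i <= m)%N -> (m <= k)%N -> `|sg m (n i) - sg m [::]| <= d * i%:R.
  elim: i => [|i IH] im mk; first by rewrite subrr normr0 mulr0.
  have -> : sg m (n i.+1) - sg m [::] =
    (sg m (n i.+1) - sg m (n i)) + (sg m (n i) - sg m [::]) by rewrite addrA subrK.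
  rewrite (le_trans (ler_normD _ _))// -natr1 mulrDr mulr1 addrC lerD ?IH ?(ltnW im)//.
  have [_ /(_ (Ordinal (mk : m < k.+1)%N))] := selP i (leq_trans im mk).
  by rewrite /= size_mkseq -nS => /(_ im).
have SG i : (i <= k)%N -> `|(G (n i)).[1] - sg i [::]| <= d * k%:R.
  move=> ik; have [hs _] := hsg i; rewrite -hs ?/n ?size_mkseq// -/(n i).
  by rewrite (le_trans (sg_near _ _ _ _))// ler_pM2l// ler_nat.
have Sb : (b (mkseq tau j.+1)).[1] =
    (G (n j.+1)).[1] - (G (n j)).[1] - (take_poly (a (tau j)) (G (n j.+1) - G (n j))).[1].
  by have := congr1 (fun p => p.[1]) (bE j); rewrite !hornerE/= expr1n mul1r.
have h1 := SG j.+1 jk; have h2 := SG j (ltnW jk).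
have h3 : `|(take_poly (a (tau j)) (G (n j.+1) - G (n j))).[1]| <= B * d.
  rewrite (le_trans (hB _))// ler_pM2l//.
  by have [+ _] := selP j jk; rewrite nS.
rewrite Sb.
set x := _.[1] in h1 *; set y := _.[1] in h2 *; set z := _.[1] in h3 *.
set s := sg _ _ in h1 *; set t := sg _ _ in h2 *.
have -> : x - y - z - (s - t) = (x - s) - (y - t) - z by ring.
rewrite (le_trans (ler_normB _ _))// (le_trans (lerD (ler_normB _ _) (lexx _)))//.
rewrite (le_trans (lerD (lerD h1 h2) h3))// dE -natr1 -addnn natrD.
by rewrite !mulrDr; have := mulrC B d; lra.
Qed.

End asymptotics.

(** * A run of small coefficient sums *)

Section slots.
Context {R : realType}.
Variable N : {poly R} -> R.
Hypothesis HN : spreading_seminorm N.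
Implicit Types (p q u v : {poly R}).

Let ND p q : N (p + q) <= N p + N q. Proof. by case: HN. Qed.
Let NZ c p : N (c *: p) = `|c| * N p. Proof. by case: HN. Qed.

Lemma dom_scale (x : R) b b' eps : x != 0 -> dom N b b' eps ->
  dom N (x *: b) (x *: b') (`|x| * eps).
Proof.
move=> x0 h u v a w w' ua; rewrite !size_scale// => bw bw'.
have E y n : u + 'X^a * (x *: y) + 'X^n * v =
    x *: (x^-1 *: u + 'X^a * y + 'X^n * (x^-1 *: v)).
  by rewrite !scalerDr [x *: ('X^a * y)]scalerAr [x *: ('X^n * _)]scalerAr !scalerA divff// !scale1r.
rewrite !E !NZ -mulrDr ler_wpM2l// h// (leq_trans _ ua)//.
exact: size_scale_leq.
Qed.

Lemma fitsD (a : nat -> nat) m (b b' : nat -> {poly R}) :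
  fits a m b -> fits a m b' -> fits a m (fun t => b t + b' t).
Proof.
move=> fb fb' t tm; have h1 := fb t tm; have h2 := fb' t tm.
have := size_polyD (b t) (b' t).
move: h1 h2; move: (size (b t)) (size (b' t)) (size _) => x y z; lia.
Qed.

Lemma fitsN (a : nat -> nat) m (b : nat -> {poly R}) :
  fits a m b -> fits a m (fun t => - b t).
Proof. by move=> fb t tm; rewrite size_polyN fb. Qed.

Lemma conf_wave (c : nat -> R) T k :
  conf (muln^~ T) k.*2 (fun t => (if odd t then - c t./2 else c t./2) *: avg T) =
  conf (muln^~ (T.*2)) k (fun i => c i *: wave T).
Proof.
elim: k => [|k IH]; first by rewrite !conf0.
rewrite doubleS !confS IH /= odd_double/= uphalf_double doubleK -addrA; congr (_ + _).
have e1 : (k.*2 * T = k * T.*2)%N by rewrite -!mul2n mulnCA mulnA.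
by rewrite mulSn e1 exprD /wave -!mul_polyC polyCN; ring.
Qed.

(** The blocks of either sign arise from the signed sum by deleting the zero-sum blocks of the other
    sign. *)
Lemma wave_signs (a : nat -> nat) m (z : nat -> {poly R}) (sg : nat -> bool) :
  (forall t, (z t).[1] = 0) -> fits a m z ->
  N (conf a m z) <= N (conf a m (fun t => (-1) ^+ sg t *: z t)) *+ 2.
Proof.
move=> z0 fz.
have fs (x : nat -> R) : fits a m (fun t => x t *: z t).
  by move=> t tm; rewrite (leq_trans _ (fz t tm))// leq_add2l size_scale_leq.
have h (x : nat -> R) : (forall t, dom N ((-1) ^+ sg t *: z t) (x t *: z t) 0) ->
    N (conf a m (fun t => x t *: z t)) <= N (conf a m (fun t => (-1) ^+ sg t *: z t)).
  move=> hx; have := @sn_conf_le _ _ HN a a m _ _ (fun=> 0)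
    (fs (fun t => (-1) ^+ sg t)) (fs x) (fun t _ => hx t).
  by rewrite big1// addr0.
have -> : conf a m z = conf a m (fun t => (~~ sg t)%:R *: z t) -
    conf a m (fun t => - (sg t)%:R *: z t).
  rewrite -confN -confD; apply: eq_conf => t _; rewrite scaleNr opprK -scalerDl.
  by case: (sg t); rewrite ?add0r ?addr0 scale1r.
have zs t : (z t).[1] = 0 /\ (- z t).[1] = 0 by rewrite hornerN z0 oppr0.
rewrite (le_trans (snB HN _ _))// mulr2n lerD//; apply: h => t; case: (sg t) => /=.
- by rewrite expr1 scaleN1r scale0r; apply: dom_zero => //; case: (zs t).
- by rewrite expr0 scale1r; exact: dom_refl.
- by rewrite expr1 scaleN1r; exact: dom_refl.
- by rewrite expr0 oppr0 scale1r scale0r; apply: dom_zero.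
Qed.

(* Some run of l consecutive coefficients is small, since otherwise the waves built
   on one large coefficient of each run would stay bounded. *)
Lemma small_run (c : nat -> R) (L : nat -> nat) (pz : nat -> nat) (M l T0 : nat)
    (A eta : R) :
  (0 < l)%N -> (0 < T0)%N -> 0 < eta -> (forall r, (0 < L r)%N) ->
  (forall r, diff_norm N (avg (L r)) <= 2^-1 ^+ r) ->
  fits pz M (fun r => wave (L r) : {poly R}) ->
  (forall T, (T0 <= T)%N -> N (conf (muln^~ (T.*2)) (M * l) (fun i => c i *: wave T)) <= A) ->
  (A / eta + 4) *+ 2 < N (conf pz M (fun r => wave (L r) : {poly R})) ->
  exists2 r, (r < M)%N & forall j, (r * l <= j < r.+1 * l)%N -> `|c j| < eta.
Proof.
move=> l0 T00 eta0 L0 dL fz hA big; apply: contrapT => nr.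
(* One large coefficient per run. For [r >= M] the start of the run is a dummy value that keeps [j]
   strictly increasing. *)
have /choice[j hj] r : exists j, (r * l <= j < r.+1 * l)%N /\ ((r < M)%N -> eta <= `|c j|).
  have [rM|Mr] := ltnP r M; last first.
    by exists (r * l)%N; split => //; rewrite leqnn/= ltn_pmul2r.
  apply: contrapT => nj; apply: nr; exists r => // i hi.
  by rewrite ltNge; apply/negP => lt; apply: nj; exists i.
have jS r : (j r < j r.+1)%N.
  by have [/andP[_ h1] _] := hj r; have [/andP[h2 _] _] := hj r.+1; exact: leq_trans h1 h2.
have j_homo : {homo j : x y / (x < y)%N} by apply: homo_ltn jS; exact: ltn_trans.
have j_inj : injective j.
  by move=> x y E; case: (ltngtP x y) => // /j_homo; rewrite E ltnn.
have jk r : (r < M)%N -> (j r < M * l)%N.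
  by move=> rM; have [/andP[_ h1] _] := hj r; rewrite (leq_trans h1)// leq_pmul2r.
(* [T] becomes a common multiple of the [L r], so that by [dom_wave] one long wave can be turned
   into any [wave (L r)]. *)
pose P := (\prod_(r < M) L r)%N.
have P0 : (0 < P)%N by rewrite prodn_gt0.
pose T := (T0 * P)%N.
have T0T : (T0 <= T)%N by rewrite leq_pmulr.
have Tdvd r : (r < M)%N -> exists2 m, (0 < m)%N & T = (L r * m)%N.
  move=> rM; exists (T0 * \prod_(i < M | i != Ordinal rM) L i)%N.
    by rewrite muln_gt0 T00 prodn_cond_gt0.
  by rewrite /T /P (bigD1 (Ordinal rM))//= mulnCA.
pose a := muln^~ (T.*2).
have fits_a (b : nat -> {poly R}) m : (forall t, (size (b t) <= T.*2)%N) -> fits a m b.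
  by move=> hb t _; rewrite /a mulSn addnC leq_add2r.
have sz r : (r < M)%N -> (size (wave (L r) : {poly R}) <= T.*2)%N.
  move=> /Tdvd[m m0 ->]; rewrite (leq_trans (size_wave _))// leq_double.
  by rewrite leq_pmulr.
pose sg r := c (j r) < 0.
pose z r : {poly R} := wave (L r).
(* Slot [j r] is shrunk from [c (j r)] to [eta] with the same sign and its wave shortened, at cost
   [2 eta 2^-r]; the other slots are emptied. The errors add up to at most [4 eta]. *)
pose b t := \sum_(r < M | j r == t) (eta * (-1) ^+ sg r) *: z r.
pose err t := \sum_(r < M | j r == t) (eta * (2^-1 ^+ r *+ 2)).
have bE t : (exists2 r, (r < M)%N & [/\ j r = t, b t = (eta * (-1) ^+ sg r) *: z r
      & err t = eta * (2^-1 ^+ r *+ 2)]) \/ (b t = 0 /\ err t = 0).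
  have [[r rM E]|nor] := pselect (exists2 r, (r < M)%N & j r = t); [left|right].
    have pr : (fun i : 'I_M => j i == t) =1 pred1 (Ordinal rM).
      by move=> i /=; rewrite -E (inj_eq j_inj) -val_eqE.
    by exists r => //; split => //; rewrite /b /err (big_pred1 _ pr).
  split; rewrite ?/b ?/err big_pred0// => r; apply/eqP => E; apply: nor;
    by exists r.
have fb : fits a (M * l) b.
  apply: fits_a => t; have [[r rM [_ -> _]]|[-> _]] := bE t; last by rewrite size_poly0.
  by rewrite (leq_trans (size_scale_leq _ _))// sz.
have fc : fits a (M * l) (fun i => c i *: wave T).
  by apply: fits_a => t; rewrite (leq_trans (size_scale_leq _ _))// size_wave.
have db t : (t < M * l)%N -> dom N (c t *: wave T) (b t) (err t).
  move=> tk; have w0 (x : R) : (x *: wave T).[1] = 0 by rewrite hornerZ wave_horner1 mulr0.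
  have [[r rM [E -> ->]]|[-> ->]] := bE t; last by apply: dom_zero.
  have [_ /(_ rM)] := hj r; rewrite E => ec.
  have c0 : 0 < `|c t| by exact: lt_le_trans ec.
  have ctE : eta * (-1) ^+ sg r = eta / `|c t| * c t.
    rewrite mulrAC -mulrA; congr (_ * _); rewrite /sg E.
    case: ltrP => ct; rewrite ?expr1 ?expr0.
      by rewrite ltr0_norm// invrN mulrN divff// lt_eqF.
    by rewrite ger0_norm// divff//; rewrite -normr_gt0.
  have h1 : dom N (c t *: wave T) ((eta * (-1) ^+ sg r) *: wave T) 0.
    rewrite ctE -scalerA; apply: dom_shrink => //.
    by apply/andP; split; [rewrite divr_ge0 ?ltW|rewrite ler_pdivrMr// mul1r].
  have [m m0 TE] := Tdvd r rM.
  have e0 : eta * (-1) ^+ sg r != 0 by rewrite mulf_neq0 ?signr_eq0 ?gt_eqF.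
  have h2 := dom_scale e0 (@dom_wave _ _ HN (L r) m m0); rewrite -TE in h2.
  have := dom_trans h1 h2; apply: dom_le; rewrite add0r normrM normr_sign mulr1 gtr0_norm//.
  by rewrite ler_wpM2l ?(ltW eta0)// mulr2n lerD.
have N1 := sn_conf_le HN fc fb db.
have sum_err : \sum_(t < M * l) err t <= eta * 4.
  rewrite /err (exchange_big_dep xpredT)//=.
  apply: (@le_trans _ _ (\sum_(r < M) eta * (2^-1 ^+ r *+ 2))).
    by apply: ler_sum => r _; rewrite (big_pred1 (Ordinal (jk r (ltn_ord r)))).
  rewrite -mulr_sumr ler_wpM2l ?(ltW eta0)//.
  have := @sum_half_le R M; rewrite sumrMnl -mulr_natr; lra.
have := le_trans N1 (lerD (hA T T0T) sum_err).
rewrite (conf_reindex a (fun r => (eta * (-1) ^+ sg r) *: z r) jk).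
have -> : conf (a \o j) M (fun r => (eta * (-1) ^+ sg r) *: z r) =
    eta *: conf (a \o j) M (fun r => (-1) ^+ sg r *: z r).
  by rewrite -confZ; apply: eq_conf => r _; rewrite scalerA.
rewrite NZ gtr0_norm// -ler_pdivlMl// mulrDr mulrA mulVf ?gt_eqF// mul1r mulrC => N2.
have fz' : fits (a \o j) M z.
  move=> r rM; rewrite (@leq_trans ((j r).+1 * T.*2)%N)//=.
    by rewrite mulSn addnC leq_add2r sz.
  by rewrite leq_mul2r jS orbT.
have z0 r : (z r).[1] = 0 by exact: wave_horner1.
have := @wave_signs (a \o j) M z sg z0 fz'.
rewrite (sn_conf_indep HN fz' fz) => N3.
have := lt_le_trans big N3; rewrite ltNge => /negP; apply.
by rewrite lerMn2r/=.
Qed.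

End slots.

(** * Comparing tuples through their slots *)

Section blocks.
Context {R : realType}.
Variable N : {poly R} -> R.
Hypothesis HN : spreading_seminorm N.
Implicit Types (p q u v : {poly R}).

Let ND p q : N (p + q) <= N p + N q. Proof. by case: HN. Qed.
Let NZ c p : N (c *: p) = `|c| * N p. Proof. by case: HN. Qed.

Implicit Types (tau : nat -> nat) (t i : nat).

Variables (k : nat) (F : (nat -> nat) -> {poly R}) (c : nat -> R) (a : nat -> nat).
Variables (b : seq nat -> {poly R}) (g : {poly R}) (eps : R).
Hypothesis k0 : (0 < k)%N.
Hypothesis eps0 : 0 < eps.
Hypothesis approx : forall tau, {homo tau : i j / (i < j)%N} ->
  N (F tau - g - \sum_(j < k) 'X^(a (tau j)) * b (mkseq tau j.+1)) <= eps /\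
  forall j, (j < k)%N ->
    (a (tau j) + size (b (mkseq tau j.+1)) <= a (tau j).+1)%N /\
    `|(b (mkseq tau j.+1)).[1] - c j| <= eps.

(** For increasing [tau] the sum has at most one term, so it is the block that [tau] puts in slot
    [t], or 0. *)
Definition slot tau t := \sum_(i < k | tau i == t) b (mkseq tau i.+1).

Lemma slot_fits tau m : {homo tau : i j / (i < j)%N} -> fits a m (slot tau).
Proof.
move=> htau t _; have [_ h] := approx htau.
have [[i ik E]|nor] := pselect (exists2 i, (i < k)%N & tau i = t).
  rewrite /slot (big_pred1 (Ordinal ik)) => [|i' /=].
    by rewrite -E; have [] := h i ik.
  rewrite -E -val_eqE/=; apply/eqP/eqP => [|->//].
  by case: (ltngtP i' i) => // /htau; lia.
rewrite /slot big_pred0 => [|i]; last by apply/eqP => E; apply: nor; exists i.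
rewrite size_poly0 addn0.
(* For an empty slot, [a t <= a t.+1] comes from the hypothesis at a sequence that starts at [t]. *)
have hs : {homo (addn t) : i j / (i < j)%N} by move=> i j ij; rewrite ltn_add2l.
have [_ /(_ 0%N k0)[+ _]] := approx hs.
by rewrite addn0; apply: leq_trans; exact: leq_addr.
Qed.

Lemma slot_conf tau m : {homo tau : i j / (i < j)%N} ->
  (forall i, (i < k)%N -> (tau i < m)%N) ->
  N (F tau - g - conf a m (slot tau)) <= eps.
Proof.
move=> htau tm; rewrite (conf_reindex a (fun i => b (mkseq tau i.+1)) tm); exact: (approx htau).1.
Qed.

Lemma slot_conf_diff tau tau' m : {homo tau : i j / (i < j)%N} ->
  {homo tau' : i j / (i < j)%N} ->
  (forall i, (i < k)%N -> (tau i < m)%N /\ (tau' i < m)%N) ->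
  N (F tau - F tau' - (conf a m (slot tau) - conf a m (slot tau'))) <= eps *+ 2.
Proof.
move=> h h' hm.
have -> : F tau - F tau' - (conf a m (slot tau) - conf a m (slot tau')) =
  (F tau - g - conf a m (slot tau)) - (F tau' - g - conf a m (slot tau')) by ring.
rewrite (le_trans (snB HN _ _))// mulr2n lerD//; apply: slot_conf => //.
  by move=> i /hm[].
by move=> i /hm[].
Qed.

Lemma slot_at tau i : {homo tau : i j / (i < j)%N} -> (i < k)%N ->
  slot tau (tau i) = b (mkseq tau i.+1).
Proof.
move=> htau ik; rewrite /slot (big_pred1 (Ordinal ik))// => i' /=.
rewrite -val_eqE/=; apply/eqP/eqP => [|->//].
by case: (ltngtP i' i) => // /htau; lia.
Qed.

Lemma slot_none tau t : (forall i, tau i != t) -> slot tau t = 0.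
Proof. by move=> h; rewrite /slot big_pred0// => i; exact/negbTE. Qed.

(** The two tuples fill the even and the odd slots, with coefficient sums near [c i] and [- c i].
    Averaging every slot turns each pair into [c i *: wave T]; each of the [2k] slots costs
    [eps N 1], and [T0] makes the averaging errors total at most 1. *)
Lemma interlaced_waves A :
  N (F (fun i => i.*2) - F (fun i => i.*2.+1)) <= A ->
  exists2 T0, (0 < T0)%N & forall T, (T0 <= T)%N ->
    N (conf (muln^~ (T.*2)) k (fun i => c i *: wave T)) <=
    A + eps *+ 2 + eps * N 1 *+ k.*2 + 1.
Proof.
set tau := fun i => i.*2; set tau' := fun i => i.*2.+1 => hA.
have htau : {homo tau : i j / (i < j)%N} by move=> i j; rewrite /tau ltn_double.
have htau' : {homo tau' : i j / (i < j)%N} by move=> i j; rewrite /tau' ltnS ltn_double.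
pose be t := slot tau t + - slot tau' t.
have fbe : fits a k.*2 be by apply: fitsD; [exact: slot_fits|apply: fitsN; exact: slot_fits].
have Nbe : N (conf a k.*2 be) <= A + eps *+ 2.
  rewrite /be confD confN.
  rewrite (le_trans (sn_le_sub HN _ (F tau - F tau')))// lerD// (snC HN).
  apply: slot_conf_diff => // i ik; rewrite /tau /tau' ltn_double; split => //.
  by rewrite -doubleS leq_double.
have /choice[K hK] t : exists K, 0 <= K /\ ((t < k.*2)%N -> forall T, (0 < T)%N ->
    dom N (be t) ((if odd t then - c t./2 else c t./2) *: avg T) (K / T%:R + eps * N 1)).
  have [tk|kt] := ltnP t k.*2; last by exists 0; split.
  have Sbe : `|(be t).[1] - (if odd t then - c t./2 else c t./2)| <= eps.
    rewrite -[t in be t]odd_double_half /be; case ot : (odd t) => /=.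
      rewrite add1n slot_none => [|i]; last first.
        by rewrite /tau; apply/eqP => E; have := odd_double i; rewrite E /= odd_double.
      rewrite -/(tau' t./2) slot_at//; last first.
        by rewrite -ltn_double (leq_ltn_trans _ tk)// -[leqRHS]odd_double_half leq_addl.
      rewrite add0r hornerN -opprD normrN; case: (approx htau') => _ /(_ t./2)[]//.
      by rewrite -ltn_double (leq_ltn_trans _ tk)// -[leqRHS]odd_double_half leq_addl.
    rewrite add0n [slot tau' _]slot_none => [|i]; last first.
      by rewrite /tau'; apply/eqP => E; have := odd_double t./2; rewrite -E /= odd_double.
    rewrite -/(tau t./2) slot_at//; last first.
      by rewrite -ltn_double (leq_ltn_trans _ tk)// -[leqRHS]odd_double_half leq_addl.
    rewrite subr0; case: (approx htau) => _ /(_ t./2)[]//.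
    by rewrite -ltn_double (leq_ltn_trans _ tk)// -[leqRHS]odd_double_half leq_addl.
  have [K K0 hK] := dom_avg HN (be t); exists K; split => // _ T T0.
  set x := (if _ then _ else _) in Sbe *.
  have := dom_trans (hK T T0) (@dom_triangle _ _ HN ((be t).[1] *: avg T) (x *: avg T)).
  apply: dom_le; rewrite lerD2l -scalerBl NZ.
  by apply: ler_pM => //; [exact: sn_ge0|exact: sn_avg1].
exists (Num.truncn (\sum_(t < k.*2) K t)).+1 => // T T0.
have Tp : (0 < T)%N by exact: leq_trans T0.
rewrite -conf_wave.
have fT : fits (muln^~ T) k.*2 (fun t => (if odd t then - c t./2 else c t./2) *: avg T).
  move=> t _; rewrite mulSn addnC leq_add2r (leq_trans (size_scale_leq _ _))//.
  exact: size_avg.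
have := sn_conf_le HN fbe fT (fun t tk => (hK t).2 tk T Tp).
move=> /le_trans; apply; rewrite big_split/= -mulr_suml sumr_const card_ord.
have KT : (\sum_(t < k.*2) K t) / T%:R <= 1.
  rewrite ler_pdivrMr ?ltr0n// mul1r ltW// (lt_le_trans (truncnS_gt _))//.
  by rewrite ler_nat.
by move: Nbe KT; move: (N _) (_ / _) => x y; lra.
Qed.

(** [n] and [m] occupy even slots, their companions odd ones. The difference of the two small
    differences is bounded by [2A], and emptying its odd slots, whose sums are nearly 0, leaves
    [F n - F m]. *)
Lemma pattern_bound (l p : nat) (eta A : R) (m m' n n' : nat -> nat) :
  n = (fun i => if (i < p + l)%N then i.*2 else (i + l).*2) ->
  m = (fun i => if (i < p)%N then i.*2 else (i + l).*2) ->
  n' = (fun i => (n i).+1) -> m' = (fun i => (m i).+1) ->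
  (p + l <= k)%N -> (forall i, (p <= i < p + l)%N -> `|c i| <= eta) ->
  N (F n - F n') <= A -> N (F m - F m') <= A ->
  N (F n - F m) <= A *+ 2 + eta * N 1 *+ l.*2 + eps *+ 6 + eps * N 1 *+ k.*2.
Proof.
move=> nE mE n'E m'E plk ceta An Am.
have hn : {homo n : i j / (i < j)%N}.
  by move=> i j ij; rewrite nE /=; case: (ltnP i (p + l)) => ?; case: (ltnP j (p + l)) => ?; lia.
have hm : {homo m : i j / (i < j)%N}.
  by move=> i j ij; rewrite mE /=; case: (ltnP i p) => ?; case: (ltnP j p) => ?; lia.
have hn' : {homo n' : i j / (i < j)%N} by move=> i j ij; rewrite n'E ltnS hn.
have hm' : {homo m' : i j / (i < j)%N} by move=> i j ij; rewrite m'E ltnS hm.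
have n_even i : odd (n i) = false by rewrite nE; case: ifP => _; rewrite odd_double.
have m_even i : odd (m i) = false by rewrite mE; case: ifP => _; rewrite odd_double.
pose w := ((k + l).*2).+2.
have nw i : (i < k)%N -> (n i < w)%N by move=> ik; rewrite nE /w; case: ifP => _; lia.
have mw i : (i < k)%N -> (m i < w)%N by move=> ik; rewrite mE /w; case: ifP => _; lia.
have nw' i : (i < k)%N -> (n' i < w)%N by move=> ik; rewrite n'E nE /w; case: ifP => _; lia.
have mw' i : (i < k)%N -> (m' i < w)%N by move=> ik; rewrite m'E mE /w; case: ifP => _; lia.
pose b1 t := slot n t - slot m t; pose b2 t := slot n' t - slot m' t.
have f1 : fits a w b1 by apply: fitsD; [exact: slot_fits|apply: fitsN; exact: slot_fits].
have f2 : fits a w b2 by apply: fitsD; [exact: slot_fits|apply: fitsN; exact: slot_fits].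
have near1 : N (F n - F m - conf a w b1) <= eps *+ 2.
  by rewrite /b1 confD confN; apply: slot_conf_diff => // i ik; rewrite nw ?mw.
have near2 : N (F n' - F m' - conf a w b2) <= eps *+ 2.
  by rewrite /b2 confD confN; apply: slot_conf_diff => // i ik; rewrite nw' ?mw'.
have N12 : N (conf a w (fun t => b1 t - b2 t)) <= A *+ 2 + eps *+ 4.
  rewrite confD confN.
  have -> : conf a w b1 - conf a w b2 =
     (F n - F n') - (F m - F m') - (F n - F m - conf a w b1) + (F n' - F m' - conf a w b2).
    by ring.
  have -> : A *+ 2 + eps *+ 4 = A + A + eps *+ 2 + eps *+ 2 by ring.
  rewrite (le_trans (ND _ _))// lerD//.
  rewrite (le_trans (snB HN _ _))// lerD//.
  by rewrite (le_trans (snB HN _ _))// lerD.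
have N1 : 0 <= N 1 by exact: sn_ge0.
have d12 t : (t < w)%N -> dom N (b1 t - b2 t) (b1 t) (`|(b2 t).[1]| * N 1).
  move=> _; case ot : (odd t).
    have -> : b1 t = 0.
      rewrite /b1 !slot_none ?subrr// => i; apply/eqP => E; move: ot; rewrite -E;
        by rewrite ?n_even ?m_even.
    rewrite sub0r -normrN -hornerN; exact: dom_sum0.
  have -> : b2 t = 0.
    rewrite /b2 !slot_none ?subrr// => i; apply/eqP => E; move: ot; rewrite -E ?n'E ?m'E/=;
      by rewrite ?n_even ?m_even.
  by rewrite subr0 horner0 normr0 mul0r; exact: dom_refl.
have f12 : fits a w (fun t => b1 t - b2 t) by apply: fitsD => //; exact: fitsN.
have N3 := sn_conf_le HN f12 f1 d12.
(* Outside of the run, n' and m' share their slots, so the sums nearly cancel. *)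
have S2 : \sum_(t < w) `|(b2 t).[1]| <= eps *+ k.*2 + eta *+ l.*2.
  pose x t i := (n' i == t)%:R * ((b (mkseq n' i.+1)).[1] - c i)
     - (m' i == t)%:R * ((b (mkseq m' i.+1)).[1] - c i)
     + ((n' i == t)%:R - (m' i == t)%:R) * c i.
  have b2E t : (b2 t).[1] = \sum_(i < k) x t i.
    rewrite /b2 hornerD hornerN /slot !horner_sum big_mkcond [X in _ - X]big_mkcond -sumrB.
    apply: eq_bigr => i _; rewrite /x; case: (n' i == t); case: (m' i == t) => /=; ring.
  have one (y : nat -> nat) i : (y i < w)%N -> \sum_(t < w) (y i == t)%:R = 1 :> R.
    move=> yw; rewrite (bigD1 (Ordinal yw))//= eqxx big1 ?addr0// => t.
    by rewrite -val_eqE/= eq_sym => /negbTE ->.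
  pose J i := (p <= i < p + l)%N.
  have nJ i : ~~ J i -> n' i = m' i.
    by rewrite /J n'E m'E nE mE; case: (ltnP i p) => ?; case: (ltnP i (p + l)) => ? //=; lia.
  have xb t i : (i < k)%N -> `|x t i| <= ((n' i == t)%:R + (m' i == t)%:R) * (eps + (J i)%:R * eta).
    move=> ik.
    have h1 : `|(b (mkseq n' i.+1)).[1] - c i| <= eps by case: (approx hn') => _ /(_ i ik)[].
    have h2 : `|(b (mkseq m' i.+1)).[1] - c i| <= eps by case: (approx hm') => _ /(_ i ik)[].
    have pos (q : bool) (u v : R) : `|u| <= v -> `|q%:R * u| <= q%:R * v.
      by move=> uv; rewrite normrM normr_nat ler_wpM2l.
    rewrite /x (le_trans (ler_normD _ _))// [leRHS]mulrDr lerD//.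
      by rewrite (le_trans (ler_normB _ _))// [leRHS]mulrDl lerD// pos.
    have [Ji|/nJ ->] := boolP (J i); last by rewrite subrr mul0r normr0 mul0r mulr0.
    rewrite mul1r mulrBl (le_trans (ler_normB _ _))// mulrDl.
    by apply: lerD; apply: pos; exact: ceta.
  apply: (@le_trans _ _ (\sum_(t < w) \sum_(i < k)
     ((n' i == t)%:R + (m' i == t)%:R) * (eps + (J i)%:R * eta))).
    apply: ler_sum => t _; rewrite b2E (le_trans (ler_norm_sum _ _ _))//.
    by apply: ler_sum => i _; exact: xb.
  rewrite exchange_big/=.
  under eq_bigr => i _.
    rewrite -mulr_suml big_split/= (one n')//; last exact: nw'.
    rewrite (one m')//; last exact: mw'.
    over.
  rewrite -mulr_sumr big_split/= sumr_const card_ord mulrDr.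
  have -> : \sum_(i < k) (J i)%:R * eta = eta *+ l.
    rewrite -mulr_suml -(big_mkord xpredT (fun i => (J i)%:R)).
    rewrite (@big_cat_nat _ _ _ (p + l))//= (@big_cat_nat _ _ _ p)//= ?leq_addr//.
    rewrite big_nat_cond big1 ?add0r => [|i]; last first.
      by rewrite andbT => /andP[_ ip]; rewrite /J leqNgt ip.
    rewrite addrC big_nat_cond big1 ?add0r => [|i]; last first.
      by rewrite andbT => /andP[ip _]; rewrite /J ltnNge ip andbF.
    rewrite big_nat_cond (eq_bigr (fun=> 1)) => [|i]; last by rewrite andbT /J => ->.
    rewrite -big_nat_cond big_const_nat addKn iter_addr_0.
    by rewrite mulr_natl.
  by rewrite -addnn -[l.*2]addnn !mulrnDr; lra.
have : N (F n - F m) <= N (conf a w b1) + eps *+ 2.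
  by rewrite (le_trans (sn_le_sub HN _ (conf a w b1)))// lerD.
move=> /le_trans; apply; move: N3; rewrite -mulr_suml => N3.
have h : (\sum_(t < w) `|(b2 t).[1]|) * N 1 <= (eps *+ k.*2 + eta *+ l.*2) * N 1.
  by rewrite ler_wpM2r.
have := le_trans N3 (lerD N12 h); rewrite mulrDl !mulrnAl => h2.
by move: h2; rewrite (_ : eps *+ 6 = eps *+ 4 + eps *+ 2) -?mulrnDr//; lra.
Qed.

End blocks.

(** * Distances between staircase points of c_0 *)

Section staircase.
Context {R : realType}.
Implicit Types (n : seq nat) (q : nat).

Definition staircase_val n q : R := (count (fun m => (q <= m)%N) n)%:R.

Lemma staircase_null n : (staircase_val n : nat -> R^o) \in @null_seq R.
Proof.
rewrite inE /=; apply: cvg_near_cst; exists (\max_(m <- n) m).+1 => //= q /= nq.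
rewrite /staircase_val (_ : count _ _ = 0%N)//; apply/eqP.
rewrite -leqn0 leqNgt -has_count -all_predC; apply/allP => m mn /=.
by rewrite -ltnNge (leq_trans _ nq)// ltnS; exact: leq_bigmax_seq.
Qed.

(* The sum over n of the elements s_m = 1_[0, m] of the summing basis of c_0. *)
Definition staircase n : c0 R := C0 (staircase_null n).

Lemma staircaseB n n' q : c0_val (staircase n - staircase n') q =
  (staircase_val n q - staircase_val n' q : R).
Proof. by []. Qed.

Lemma staircase_mkseq (f : nat -> nat) k q :
  staircase_val (mkseq f k) q = \sum_(i < k) (q <= f i)%N%:R.
Proof.
elim: k => [|k IH]; first by rewrite big_ord0.
rewrite big_ord_recr/= -IH /staircase_val mkseqS -cats1 count_cat natrD /=.
by rewrite addn0.
Qed.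

Lemma staircase_norm n : `|staircase n - staircase [::]| <= (size n)%:R.
Proof.
apply: c0_norm_le => q; rewrite staircaseB [X in _ - X](_ : _ = 0)// subr0.
by rewrite ger0_norm ?ler0n// ler_nat count_size.
Qed.

(** At each coordinate the indicators satisfy [u i <= v i <= u i.+1], so their sums differ by at
    most one last term. *)
Lemma staircase_interlaced (f g : nat -> nat) k :
  (forall i, f i <= g i)%N -> (forall i, g i <= f i.+1)%N ->
  `|staircase (mkseq f k) - staircase (mkseq g k)| <= 1.
Proof.
move=> fg gf; apply: c0_norm_le => q.
rewrite staircaseB !staircase_mkseq.
pose u i : R := (q <= f i)%N%:R; pose v i : R := (q <= g i)%N%:R.
have uv i : u i <= v i.
  by rewrite /u /v; case: leqP => [h|_]; rewrite ?ler0n// (leq_trans h).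
have vu i : v i <= u i.+1.
  by rewrite /u /v; case: leqP => [h|_]; rewrite ?ler0n// (leq_trans h).
have lo : \sum_(i < k) u i <= \sum_(i < k) v i by apply: ler_sum => i _.
have up : \sum_(i < k) v i <= \sum_(i < k) u i + u k.
  elim: k {lo} => [|k IH]; first by rewrite !big_ord0 add0r ler0n.
  by rewrite !big_ord_recr/= lerD.
have u1 : u k <= 1 by rewrite /u; case: (_ <= _)%N.
by rewrite -/(\sum_(i < k) u i) -/(\sum_(i < k) v i) ler_norml; apply/andP; split; lra.
Qed.

(** At the coordinate [g p], every [g i] of the run is counted, no [f i] is, and the other indices
    cancel. *)
Lemma staircase_separated (f g : nat -> nat) k p l : (p + l <= k)%N ->
  (forall i, ~~ (p <= i < p + l)%N -> f i = g i) ->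
  (forall i, (p <= i < p + l)%N -> (f i < g p)%N && (g p <= g i)%N) ->
  l%:R <= `|staircase (mkseq f k) - staircase (mkseq g k)|.
Proof.
move=> plk fg fgp; apply: le_trans (c0_norm_ub _ (g p)).
rewrite staircaseB !staircase_mkseq distrC -sumrB.
rewrite (_ : \sum_(i < k) _ = l%:R) ?normr_nat//.
rewrite -(big_mkord xpredT (fun i => (g p <= g i)%N%:R - (g p <= f i)%N%:R)).
rewrite (@big_cat_nat _ _ _ (p + l))//= (@big_cat_nat _ _ _ p)//= ?leq_addr//.
rewrite big_nat big1 ?add0r => [|i /andP[_ ip]]; last first.
  by rewrite fg ?subrr// leqNgt ip.
rewrite addrC big_nat big1 ?add0r => [|i /andP[ip _]]; last first.
  by rewrite fg ?subrr// [(i < _)%N]ltnNge ip andbF.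
rewrite big_nat (eq_bigr (fun=> 1)) => [|i /fgp/andP[h1 h2]]; last first.
  by rewrite h2 leqNgt h1 subr0.
by rewrite -big_nat big_const_nat addKn iter_addr_0.
Qed.

End staircase.
Arguments staircase {R} n.

(** * The two patterns and the contradiction *)

(** The even numbers with [l] of them skipped at index [p]. The odd numbers stay free for the
    interlaced companion; skipping at [p + l] or at [p] changes only the run from [p]. *)
Definition shifted (p l i : nat) := if (i < p)%N then i.*2 else (i + l).*2.

Lemma shifted_gap p l i : ((shifted p l i).+1 <= shifted p l i.+1)%N.
Proof. by rewrite /shifted; case: (ltnP i p) => ?; case: (ltnP i.+1 p) => ?; lia. Qed.

Lemma shifted_outside p l i : ~~ (p <= i < p + l)%N ->
  shifted (p + l) l i = shifted p l i.
Proof.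
by rewrite /shifted; case: (ltnP i p) => ?; case: (ltnP i (p + l)) => ? //=; lia.
Qed.

Lemma shifted_inside p l i : (p <= i < p + l)%N ->
  (shifted (p + l) l i < shifted p l p)%N && (shifted p l p <= shifted p l i)%N.
Proof.
move=> /andP[pi ipl]; rewrite /shifted ipl ltnn [(i < p)%N]ltnNge pi /=.
by rewrite ltn_double ipl leq_double leq_add2r.
Qed.

Theorem theorem21 (R : realType) (X : completeNormedModType R) (e : nat -> X) :
  is_dual_space X -> conditional_spreading_basis e -> ~ coarsely_embeds (c0 R) X.
Proof.
move=> Xd Ce [phi [rho [omega [pos mono rho_oo emb]]]].
pose N := vnorm e; have HN : spreading_seminorm N := cond_spreading Ce.
have Ee : schauder_basis e by case: Ce.
have N1 : 0 <= N 1 by exact: sn_ge0.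
have N1p : 0 < N 1 + 1 by rewrite ltr_wpDl.
have [_ Om0] := pos 1 ler01.
(* Values of [phi] are replaced by polynomials within 1, which adds 2 to every distance. *)
pose Ap := omega 1 + 2.
have Ap0 : 0 <= Ap by rewrite addr_ge0.
(* The estimates below give [rho l <= 2 omega 1 + 9]: [2 Ap], 2 for the approximation, and 1 for
   each of three error terms. *)
have [l l0 hl] : exists2 l, (0 < l)%N & omega 1 *+ 2 + 10 <= rho l%:R.
  have /cvgryPge/(_ (omega 1 *+ 2 + 10))[t [_ ht]] := rho_oo.
  exists (Num.truncn `|t|).+1 => //; apply: ht.
  by rewrite (le_lt_trans (ler_norm t))// truncnS_gt.
have lR : 0 < l%:R :> R by rewrite ltr0n.
pose eta := (l%:R * 2 * (N 1 + 1))^-1.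
have eta0 : 0 < eta by rewrite invr_gt0 !mulr_gt0.
have etal : eta * N 1 *+ l.*2 <= 1.
  have -> : eta * N 1 *+ l.*2 = N 1 / (N 1 + 1).
    by rewrite -mulr_natr -muln2 natrM /eta; field; rewrite !gt_eqF.
  by rewrite ler_pdivrMr// mul1r lerDl.
have half0 r : 0 < (2^-1 : R) ^+ r by rewrite exprn_gt0// invr_gt0.
have /choice[L hL] r : exists T, (0 < T)%N /\ diff_norm N (avg T) < 2^-1 ^+ r.
  by have [T T0 hT] := cond_diff_small Ce (half0 r); exists T.
pose z r : {poly R} := wave (L r).
pose pz r := (\sum_(i < r) size (z i))%N.
have fz m : fits pz m z by move=> t _; rewrite /pz big_ord_recr.
have [d d0 hd] := wave_lower Ce.
(* The threshold is that of [small_run] for the bound [Ap + 3] obtained from [interlaced_waves]. It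
   involves neither [k] nor [eps], which are chosen afterwards. *)
have [M hM] := @zero_sum_blocks_unbounded _ _ e Xd Ce pz z d
  (((Ap + 3) / eta + 4) *+ 2) d0 (fun r => wave_horner1 _) fz (fun r => hd _ (hL r).1).
have M0 : (0 < M)%N.
  case: M hM => // /lt_le_trans - /(_ 0); rewrite conf0 -/N (sn0 HN) lexx => /(_ isT).
  by rewrite ltNge mulrn_wge0// addr_ge0// divr_ge0 ?addr_ge0// ltW.
pose k := (M * l)%N; have k0 : (0 < k)%N by rewrite muln_gt0 M0.
pose eps := (6 * k.+1%:R * (N 1 + 1))^-1.
have eps0 : 0 < eps by rewrite invr_gt0 !mulr_gt0.
have epsE : eps * 6 * k.+1%:R * (N 1 + 1) = 1.
  by rewrite -!mulrA [6 * _]mulrA mulVf// !mulf_neq0 ?gt_eqF.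
have ek : 0 <= eps * (k%:R * N 1) := mulr_ge0 (ltW eps0) (mulr_ge0 (ler0n _ _) N1).
have ekN : eps * 6 + eps * 6 * (k%:R * N 1) <= 1.
  rewrite -[leRHS]epsE -[k.+1%:R]natr1.
  have := mulr_ge0 (ltW eps0) (ler0n R k); have := mulr_ge0 (ltW eps0) N1.
  by move: (k%:R : R) => y; lra.
have eps6 : eps *+ 6 <= 1 by rewrite -mulr_natr; lra.
have epsk : eps * N 1 *+ k.*2 <= 1.
  by rewrite -mulr_natr -muln2 natrM; move: ek ekN eps0; move: (k%:R : R) => y; lra.
have /choice[ap hap] x : exists q : {poly R}, `|phi x - vec e q| <= 1.
  have [a [ax _]] := Ee (phi x).
  have /cvgrPdist_le/(_ _ ltr01)[n _ /(_ n (leqnn _))/=] := ax.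
  by rewrite series_vec => h; exists (\poly_(i < n) a i).
(* Truncation to [k] entries keeps the staircases within distance [k] of 0, so [f] is bounded on
   tuples of all lengths. *)
pose f n := ap (staircase (take k n)).
pose dphi n n' := `|phi (staircase (take k n)) - phi (staircase (take k n'))|.
have near_f n n' : N (f n - f n') <= dphi n n' + 2 /\ dphi n n' - 2 <= N (f n - f n').
  have : `|N (f n - f n') - dphi n n'| <= 2.
    rewrite /N /vnorm vecB (le_trans (ler_dist_dist _ _))//.
    set x := phi _; set y := phi _.
    have -> : vec e (f n) - vec e (f n') - (x - y) = (y - vec e (f n')) - (x - vec e (f n)).
      by rewrite !opprB [LHS]addrACA [RHS]addrACA; congr (_ + _); exact: addrC.
    by rewrite (le_trans (ler_normB _ _))// -[2]/(1 + 1) lerD// hap.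
  by rewrite ler_norml => /andP[? ?]; split; lra.
have fC n : N (f n) <= N (f [::]) + (omega k%:R + 2).
  rewrite (le_trans (sn_le_sub HN _ (f [::])))// lerD2l.
  apply: (le_trans (near_f n [::]).1); rewrite lerD2r/=; have [_ /le_trans] := andP (emb (staircase (take k n)) (staircase [::])).
  apply; apply: (mono _ _ _ _).2 => //; rewrite (le_trans (staircase_norm _))// ler_nat.
  by rewrite size_take; case: ltnP.
have [c [nu [a [b [g [hnu approx]]]]]] := @asymptotic_blocks _ _ e Xd Ce k f _ eps fC eps0.
pose F tau := f (mkseq (nu \o tau) k).
have takeF tau : take k (mkseq (nu \o tau) k) = mkseq (nu \o tau) k.
  by rewrite take_oversize ?size_mkseq.
have nu_le : {homo nu : i j / (i <= j)%N}.
  by move=> i j; rewrite leq_eqVlt => /predU1P[->//|/hnu/ltnW].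
have F_interlaced tau : (forall i, (tau i).+1 <= tau i.+1)%N ->
    N (F tau - F (fun i => (tau i).+1)) <= Ap.
  move=> htau; apply: (le_trans (near_f _ _).1); rewrite /Ap lerD2r /dphi !takeF.
  have [_ /le_trans] := andP (emb (staircase (mkseq (nu \o tau) k))
    (staircase (mkseq (nu \o (fun i => (tau i).+1)) k))).
  apply; apply: (mono _ _ _ _).2 => //; apply: staircase_interlaced => i /=.
    exact: nu_le.
  by apply: nu_le.
have [T0 T00 hT] := interlaced_waves HN k0 eps0 approx
  (F_interlaced _ (fun i => leqnSn _ : (i.*2.+1 <= i.+1.*2)%N)).
have hT' T : (T0 <= T)%N ->
    N (conf (muln^~ (T.*2)) k (fun i => c i *: wave T)) <= Ap + 3.
  move=> /hT /le_trans; apply; move: eps6 epsk eps0; rewrite -!(mulr_natr eps); lra.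
have [r rM hr] := small_run HN l0 T00 eta0 (fun r => (hL r).1)
  (fun r => ltW (hL r).2) (fz M) hT' hM.
pose p := (r * l)%N.
have plk : (p + l <= k)%N by rewrite /p addnC -mulSn leq_mul2r rM orbT.
have hc i : (p <= i < p + l)%N -> `|c i| <= eta.
  by move=> hi; rewrite ltW// hr// mulSn addnC.
pose n := shifted (p + l) l; pose m := shifted p l.
have up := @pattern_bound _ _ HN k F c a b g eps k0 eps0 approx l p eta Ap m _ n _
  erefl erefl erefl erefl plk hc (F_interlaced n (shifted_gap _ _)) (F_interlaced m (shifted_gap _ _)).
have sep : l%:R <= `|staircase (mkseq (nu \o n) k) - staircase (mkseq (nu \o m) k)| :> R.
  apply: (@staircase_separated _ _ _ k p) => // i hi /=.
    by rewrite /n shifted_outside.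
  by have /andP[h1 h2] := shifted_inside hi; rewrite hnu// nu_le.
have lo : rho l%:R - 2 <= N (F n - F m).
  apply: le_trans (near_f _ _).2; rewrite lerD2r /dphi !takeF.
  have /andP[+ _] := emb (staircase (mkseq (nu \o n) k)) (staircase (mkseq (nu \o m) k)).
  by apply: le_trans; apply: (mono _ _ _ sep).1.
move: (le_trans lo up) hl etal eps6 epsk; rewrite /Ap.
by rewrite -!(mulr_natr eps) -!(mulr_natr (omega _)) -(mulr_natr (_ + _)); lra.
Qed.
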